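(* Let $M\in\mathbb{R}^{d\times d}$ be Hurwitz and $C\in\mathbb{R}^{d\times n}$ with $(M,C)$ controllable, and write $M=(J-A)\Sigma^{-1}$ with $\Sigma,A,J$ as defined in the context. Let $K\in\mathbb{R}^{d\times d}$ with $-K_{11}\in\mathbb{R}^{k\times k}$ Hurwitz. Define $\hat M:=\alpha M_{12}+M_{22}\in\mathbb{R}^{(d-k)\times(d-k)}$, where $\alpha=-K_{21}K_{11}^{-1}$, and let $\hat C\in\mathbb{R}^{(d-k)\times n}$ be the matrix $(\alpha C_{11}+C_{21}\ \ \alpha C_{12}+C_{22})$. Assume that $\hat M$ is Hurwitz and that $(\hat M,\hat C)$ is controllable. Then the dynamics $Y_t=(Y^1_t,Y^2_t)^T$ in $\mathbb{R}^k\times\mathbb{R}^{d-k}$ given by $$dY_t=P(J-A)\Sigma^{-1}Y_t\,dt+\sqrt2\,PC\,dW_t,\qquad P=\begin{pmatrix}0&0\\\alpha&I\end{pmatrix},$$ (for which $Y^1_t\equiv Y^1_0$) with fixed value $Y^1_0\in\mathbb{R}^k$ admits the unique invariant measure $\mu^{\varepsilon=0}\in\mathcal{P}(\mathbb{R}^d)$ given by $$\mu^{\varepsilon=0}(dy^1,dy^2)=\delta_{Y^1_0}(dy^1)\,\hat\mu^{\varepsilon=0}(dy^2),\qquad \hat\mu^{\varepsilon=0}=\mathcal{N}(\hat m,\hat\Sigma)\in\mathcal{P}(\mathbb{R}^{d-k}),$$ where $\delta$ is the Dirac measure, the mean is $$\hat m=-\hat M^{-1}(\alpha M_{11}+M_{21})Y^1_0\in\mathbb{R}^{d-k},$$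 and the covariance $\hat\Sigma\in\mathbb{R}^{(d-k)\times(d-k)}$ is the unique positive definite solution to $$\hat M\hat\Sigma+\hat\Sigma\hat M^T=-2\hat C\hat C^T.$$ Moreover, with $m_c=\Sigma_{21}\Sigma_{11}^{-1}b$ and $\Sigma_c=\Sigma_{22}-\Sigma_{21}\Sigma_{11}^{-1}\Sigma_{12}$ for a given $b\in\mathbb{R}^k$, one has $\hat\Sigma=\Sigma_c$ if and only if the matrix $$(\alpha+\Sigma_{21}\Sigma_{11}^{-1})\big((J_{11}+A_{11})\alpha^T+(J_{12}+A_{12})\big)\in\mathbb{R}^{(d-k)\times(d-k)}$$ is skew-symmetric. Assuming well-prepared initial datum $Y^1_0=b$, we have $\hat m=m_c$ if and only if $b$ is in the kernel of the matrix $$\Sigma_{21}\Sigma_{11}^{-1}+\hat M^{-1}(\alpha M_{11}+M_{21})\in\mathbb{R}^{(d-k)\times k}.$$ In particular, $\hat m=m_c$ for $b=0$.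
   Context: Here $1\le k<d$. Vectors are split as $x=(x^1,x^2)^T\in\mathbb{R}^k\times\mathbb{R}^{d-k}$, and a matrix $S\in\mathbb{R}^{d\times d}$ is partitioned as $S=\begin{pmatrix}S_{11}&S_{12}\\S_{21}&S_{22}\end{pmatrix}$ with $S_{11}\in\mathbb{R}^{k\times k}$, $S_{22}\in\mathbb{R}^{(d-k)\times(d-k)}$. For $C\in\mathbb{R}^{d\times n}$ the rows are split in the same way and the columns into two consecutive groups, so that $\hat C$ is the matrix of the last $d-k$ rows of $PC$. $W_t$ is a standard Brownian motion in $\mathbb{R}^n$. A matrix is Hurwitz if all its eigenvalues have strictly negative real part. A pair $(M,C)$ with $M\in\mathbb{R}^{r\times r}$ and $C$ having $r$ rows is controllable if $\mathrm{rank}[C,MC,\ldots,M^{r-1}C]=r$. Standing definitions: $\Sigma\in\mathbb{R}^{d\times d}$ is the unique symmetric positive definite solution of $M\Sigma+\Sigma M^T=-2CC^T$ (so $\mu=\mathcal{N}(0,\Sigma)$ is the unique invariant measure of $dX_t=MX_t\,dt+\sqrt2\,C\,dW_t$); $A:=CC^T$ is symmetric positive semidefinite; $J:=\frac12(M\Sigma-\Sigma M^T)$ is skew-symmetric; then $M=(J-A)\Sigma^{-1}$. The measure $\mu_c=\mathcal{N}(m_c,\Sigma_c)\in\mathcal{P}(\mathbb{R}^{d-k})$ is the conditional distribution of $x^2$ given $x^1=b$ under $\mu$. *)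

(* Defs.v *)
From HB Require Import structures.
From mathcomp Require Import all_boot all_order all_algebra.
From mathcomp Require Import all_classical all_reals all_analysis.
From mathcomp.real_closed Require Import complex.

Set Implicit Arguments.
Unset Strict Implicit.
Unset Printing Implicit Defensive.

Import Order.TTheory GRing.Theory Num.Theory.
Import numFieldNormedType.Exports.

Local Open Scope classical_set_scope.
Local Open Scope ring_scope.

Section linear_algebra.
Context {R : realType}.

(* The eigenvalues are the complex ones, so M is first mapped into R[i]. *)
Definition hurwitz n (M : 'M[R]_n) : Prop :=
  forall z : R[i], eigenvalue (map_mx (real_complex R) M) z -> complex.Re z < 0.

Definition controllable r n (M : 'M[R]_r) (C : 'M[R]_(r, n)) : Prop :=
  \rank (\mxrow_(j < r) (M ^+ j *m C)) = r.

Definition posdef n (S : 'M[R]_n) : Prop :=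
  S^T = S /\ forall v : 'cV[R]_n, v != 0 -> 0 < (v^T *m S *m v) 0 0.

Definition lyapunov_solution n p (M : 'M[R]_n) (C : 'M[R]_(n, p))
    (S : 'M[R]_n) : Prop :=
  posdef S /\ M *m S + S *m M^T = (- 2) *: (C *m C^T).

Definition skew_symmetric n (S : 'M[R]_n) : Prop := S^T = - S.

End linear_algebra.

(* R^n carries the sigma-algebra generated by the coordinates, i.e. its Borel
   sigma-algebra, as n.-tuple R does in the library. *)
Section measurable_cV.
Context {R : realType} (n : nat).

Let coors : 'I_n -> 'cV[R]_n -> R := fun i x => x i 0.

Let cV_set0 : g_sigma_preimage coors set0.
Proof. exact: sigma_algebra0. Qed.

Let cV_setC A : g_sigma_preimage coors A -> g_sigma_preimage coors (~` A).
Proof. exact: sigma_algebraC. Qed.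

Let cV_bigcup (F : _^nat) : (forall i, g_sigma_preimage coors (F i)) ->
  g_sigma_preimage coors (\bigcup_i (F i)).
Proof. exact: sigma_algebra_bigcup. Qed.

HB.instance Definition _ := @isMeasurable.Build default_measure_display
  'cV[R]_n (g_sigma_preimage coors) cV_set0 cV_setC cV_bigcup.

End measurable_cV.

Section gaussian.
Context {R : realType}.

(* N(m, v) on the line with variance v, which is the Dirac mass at m when
   v = 0; the library's normal_prob takes the standard deviation and has an
   unrelated meaning when that is 0. *)
Definition normal_law (m v : R) : set R -> \bar R :=
  if v == 0 then \d_m else normal_prob m (Num.sqrt v).

(* mu = N(m, S): every linear functional x |-> u^T x has law
   N(u^T m, u^T S u) under mu. *)
Definition gaussian n (mu : set 'cV[R]_n -> \bar R) (m : 'cV[R]_n)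
    (S : 'M[R]_n) : Prop :=
  forall (u : 'cV[R]_n) (A : set R), measurable A ->
    mu [set x | A ((u^T *m x) 0 0)] =
    normal_law ((u^T *m m) 0 0) ((u^T *m S *m u) 0 0) A.

(* The product of m1 on R^k and m2 on R^l, as a measure on R^(k + l). *)
Definition cV_product k l (m1 : probability 'cV[R]_k R)
    (m2 : probability 'cV[R]_l R) : set 'cV[R]_(k + l) -> \bar R :=
  pushforward (m1 \x m2)%E (fun p => col_mx p.1 p.2).

End gaussian.

Section sde.
Context {R : realType} {d : measure_display} {Omega : measurableType d}.
Variable Pr : probability Omega R.

Record brownian_motion n (W : R -> Omega -> 'cV[R]_n) : Prop := {
  brownian_measurable : forall t, 0 <= t -> measurable_fun setT (W t) ;
  brownian_start : {ae Pr, forall w, W 0 w = 0} ;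
  brownian_continuous :
    {ae Pr, forall w, {within `[0, +oo[, continuous (W ^~ w)}} ;
  brownian_independent : forall (m : nat) (t : nat -> R)
      (A : nat -> set 'cV[R]_n),
    0 <= t 0%N -> (forall i, t i <= t i.+1) -> (forall i, measurable (A i)) ->
    Pr (\bigcap_(i < m) [set w | A i (W (t i.+1) w - W (t i) w)]) =
    (\prod_(i < m) Pr [set w | A i (W (t i.+1) w - W (t i) w)%R])%E ;
  brownian_gaussian : forall s t, 0 <= s <= t ->
    gaussian (pushforward Pr (fun w => W t w - W s w)) 0 ((t - s)%:M)
}.

(* X solves dX_t = B X_t dt + S dW_t, X_0 = x. As the noise is additive, the
   stochastic integral of the constant matrix S is S W_t, and the equation is
   a pathwise integral equation. *)
Record sde_solution n p (W : R -> Omega -> 'cV[R]_p) (B : 'M[R]_n)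
    (S : 'M[R]_(n, p)) (x : 'cV[R]_n) (X : R -> Omega -> 'cV[R]_n) : Prop := {
  sde_measurable : forall t, 0 <= t -> measurable_fun setT (X t) ;
  sde_continuous :
    {ae Pr, forall w, {within `[0, +oo[, continuous (X ^~ w)}} ;
  sde_equation : {ae Pr, forall w, forall t, 0 <= t ->
    X t w = x
      + \col_i \int[lebesgue_measure]_(s in `[0, t]) (B *m X s w) i 0
      + S *m W t w}
}.

(* mu is invariant for the Markov semigroup of dX_t = B X_t dt + S dW_t, whose
   transition function is p_t(x, A) = Pr (X_t \in A) for the solution X
   started at x: mu p_t = mu for every t >= 0. *)
Definition invariant_measure n p (W : R -> Omega -> 'cV[R]_p) (B : 'M[R]_n)
    (S : 'M[R]_(n, p)) (mu : probability 'cV[R]_n R) : Prop :=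
  exists X : 'cV[R]_n -> R -> Omega -> 'cV[R]_n,
    (forall x, sde_solution W B S x (X x)) /\
    forall (t : R) (A : set 'cV[R]_n), 0 <= t -> measurable A ->
      (\int[mu]_x Pr [set w | A (X x t w)] = mu A)%E.

End sde.

(* Main.v *)
(* As M = (J - A) Sigma^-1, the drift P M = [0 0; N hatM], where
   N = alpha M11 + M21, and the noise sqrt 2 P C = sqrt 2 [0; hatC] do not move
   the first block, and the second block is an Ornstein-Uhlenbeck process with
   an affine drift.

   Write E for the exponential of the drift B, S for the noise matrix,
   m = (y1, hatm) for the zero of the drift over y1 and G = diag (0, hatSigma),
   so that B G + G B^T = - S S^T. Integrating by parts, the pathwise unique
   solution is E(t) x + xi_t, where xi_t = S W_t + int_0^t E(t - s) B S W_s ds is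
   a limit of Stieltjes sums of Brownian increments. Hence
   E cos(u.xi_t + c) = phi(u.(G - E(t) G E(t)^T)u) cos c, where
   phi v = E cos N(0, v) is multiplicative on sums of variances. The functions
   cos(u.x + c) determine a law on R^n, because they span, up to bounded
   pointwise limits, all bounded measurable functions. So the law mu with
   E_mu cos(u.x + c) = phi(u.Gu) cos(u.m + c) is invariant, and it is the only
   invariant law over y1, since E(t) contracts the fibre {y1} x R^l to m.

   For the covariance, hatSigma = Sigma_c iff the Schur complement Sigma_c of
   Sigma solves the Lyapunov equation of (hatM, hatC). With the projection
   p = (alpha 1) and e = (- Sigma11^-1 Sigma12; 1), one has
   Sigma e = (0; Sigma_c), so hatM Sigma_c = p M Sigma e = p (J - A) e, and
   e = p^T - (alpha + Sigma21 Sigma11^-1, 0)^T turns the equation into the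
   skew-symmetry condition. *)
From HB Require Import structures.
Require Import Defs.
From mathcomp Require Import all_boot all_order all_algebra.
From mathcomp Require Import all_classical all_reals all_analysis.
From mathcomp.real_closed Require Import complex.
From mathcomp Require Import measurable_realfun.
From mathcomp Require Import ring lra.
Import Order.TTheory GRing.Theory Num.Theory.
Import numFieldNormedType.Exports.
Local Open Scope classical_set_scope.
Local Open Scope ring_scope.
Set Implicit Arguments.
Unset Strict Implicit.
Unset Printing Implicit Defensive.

(** * Matrix exponential *)

Section cvg_sum.
Context {R : realType}.

(** The drift B has a zero block, so it is not Hurwitz and E(t) does not tend to 0; only its
    restriction to {0} x R^l does. Decay of the block system is therefore always stated for
    [expm B t *m col_mx 0 1%:M]. It is obtained by splitting the characteristic polynomial over R[i]
    and using one scalar differential inequality per root, which avoids Jordan forms.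

    Real cosines with a free phase replace the complex characteristic function: shifting the phase
    by pi / 2 gives sines, so real expectations of bounded functions suffice.

    The Brownian motion is the only source of randomness at hand, so the Gaussian laws whose
    existence is claimed are built as images of its increments. This takes at least one noise
    coordinate, which controllability with l > 0 provides.

    Brownian paths are continuous only almost surely and only on nonnegative times. The exceptional
    null set is removed once, in [regular_version], after which the pathwise calculus holds for
    every sample point. *)

Lemma cvg_sumR (I T : Type) (F : set_system T) {FF : Filter F} (r : seq I)
    (f : I -> T -> R) (l : I -> R) :
  (forall i, f i x @[x --> F] --> l i) ->
  (\sum_(i <- r) f i x) @[x --> F] --> \sum_(i <- r) l i.
Proof.
move=> fl; elim: r => [|i r IH].
  by under eq_fun do rewrite big_nil; rewrite big_nil; exact: cvg_cst.
by under eq_fun do rewrite big_cons; rewrite big_cons; exact: cvgD.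
Qed.

End cvg_sum.

Section matrix_derivative.
Context {R : realType}.

Definition mderive m n (F : R -> 'M[R]_(m, n)) (dF : 'M[R]_(m, n)) (t : R) :=
  forall i j, is_derive t 1 (fun s => F s i j) (dF i j).

Lemma mderive_cst m n (A : 'M[R]_(m, n)) t : mderive (fun=> A) 0 t.
Proof. by move=> i j; rewrite mxE; exact: is_derive_cst. Qed.

Lemma mderiveD m n (F G : R -> 'M[R]_(m, n)) dF dG t :
  mderive F dF t -> mderive G dG t ->
  mderive (fun s => F s + G s) (dF + dG) t.
Proof.
move=> hF hG i j; rewrite mxE.
under eq_fun do rewrite mxE.
exact: is_deriveD.
Qed.

Lemma mderive_mul m n p (F : R -> 'M[R]_(m, n)) (G : R -> 'M[R]_(n, p))
    dF dG t : mderive F dF t -> mderive G dG t ->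
  mderive (fun s => F s *m G s) (dF *m G t + F t *m dG) t.
Proof.
move=> hF hG i j; rewrite !mxE -big_split /=.
rewrite (_ : (fun s => _) =
  \sum_(k < n) (fun s => F s i k * G s k j)); last first.
  by apply/funext => s; rewrite mxE fct_sumE.
apply: is_derive_sum => k.
apply: is_derive_eq; first exact: is_deriveM (hF i k) (hG k j).
by rewrite /= addrC; congr (_ + _); exact: mulrC.
Qed.

Lemma mderive_tr m n (F : R -> 'M[R]_(m, n)) dF t :
  mderive F dF t -> mderive (fun s => (F s)^T) dF^T t.
Proof.
by move=> hF i j; rewrite mxE; under eq_fun do rewrite mxE; exact: hF.
Qed.

Lemma mderiveN m n (F : R -> 'M[R]_(m, n)) dF t :
  mderive F dF (- t) -> mderive (fun s => F (- s)) (- dF) t.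
Proof.
move=> hF i j; rewrite mxE.
have h1 : is_derive t 1 (fun s : R => - s) (-1) by apply: is_deriveN.
have := @is_derive1_comp R (fun s => F s i j) (fun s => - s) t _ _ (hF i j) h1.
by rewrite mulrN1.
Qed.

Lemma mderive_cstE m n (F : R -> 'M[R]_(m, n)) :
  (forall t, mderive F 0 t) -> forall t s, F t = F s.
Proof.
move=> hF t s; apply/matrixP => i j.
by apply: (is_derive_0_is_cst (f := fun s => F s i j)) => x; have := hF x i j; rewrite mxE.
Qed.

End matrix_derivative.

Section matrix_exponential.
Context {R : realType} {n : nat}.
Variable B : 'M[R]_n.

(** The coefficients of an entry of B^p exp(tB). Termwise differentiation sends index [p] to [p.+1],
    so derivatives stay within the family. *)
Let c (p : nat) i j (k : nat) : R := (B ^+ (k + p)) i j / k`!%:R.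

Definition expm (t : R) : 'M[R]_n := \matrix_(i, j) limn (pseries (c 0 i j) t).

Let K : R := \sum_i \sum_j `|B i j|.

Let K_ge0 : 0 <= K.
Proof. by apply: sumr_ge0 => i _; apply: sumr_ge0. Qed.

Let expmx_bound k i j : `|(B ^+ k) i j| <= K ^+ k.
Proof.
elim: k i => [|k IH] i.
  by rewrite !expr0 mxE; case: (i == j); rewrite ?normr1// normr0.
rewrite !exprS mxE (le_trans (ler_norm_sum _ _ _))//.
have : \sum_l `|B i l| <= K.
  rewrite /K [leRHS](bigD1 i)//= lerDl; apply: sumr_ge0 => i' _; exact: sumr_ge0.
move=> /(ler_wpM2r (exprn_ge0 k K_ge0)); apply: le_trans.
rewrite mulr_suml; apply: ler_sum => l _; rewrite normrM.
exact: ler_wpM2l.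
Qed.

Let is_cvg_c p i j t : cvgn (pseries (c p i j) t).
Proof.
apply: normed_cvg.
apply: (@series_le_cvg _ _ (fun k => K ^+ p * exp_coeff (K * `|t|) k)) => [k|k|k|].
- exact: normr_ge0.
- rewrite mulr_ge0 ?exprn_ge0 // /exp_coeff /= mulr_ge0 ?invr_ge0//.
  by rewrite exprn_ge0// mulr_ge0.
- rewrite /c /exp_coeff /= !normrM normfV normr_nat normrX.
  have -> : K ^+ p * ((K * `|t|) ^+ k / k`!%:R) =
      K ^+ (k + p) / k`!%:R * `|t| ^+ k by rewrite exprMn exprD; ring.
  by rewrite ler_wpM2r ?exprn_ge0// ler_wpM2r ?invr_ge0.
- rewrite (_ : series _ = K ^+ p *: series (exp_coeff (K * `|t|))).
    by apply: is_cvgZl_tmp; exact: is_cvg_series_exp_coeff.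
  by apply/funext => k; rewrite /series /= fctE /GRing.scale /= mulr_sumr.
Qed.

Let cvg_c p i j t : pseries (c p i j) t @ \oo --> limn (pseries (c p i j) t).
Proof. exact: is_cvg_c. Qed.

Let c_diffs p i j : pseries_diffs (c p i j) = c p.+1 i j.
Proof.
apply/funext => k; rewrite /pseries_diffs /c addSnnS factS natrM invfM.
by rewrite mulrCA mulVKf// pnatr_eq0.
Qed.

Let is_derive_expm (i j : 'I_n) (t : R) :
  is_derive t 1 (fun s => expm s i j) (limn (pseries (c 1 i j) t)).
Proof.
under eq_fun do rewrite mxE.
rewrite -(c_diffs 0).
(* Termwise differentiation at [t] asks for convergence of the series and of its two formal
   derivatives at a point of modulus larger than that of [t]. *)
apply: (@pseries_snd_diffs _ _ (`|t| + 1)); rewrite ?c_diffs; [exact: is_cvg_c..|].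
by rewrite [ltRHS]ger0_norm ?ltrDl// addr_ge0.
Qed.

(** The extra factor of B^(k+1) is split off on the left here and on the right in [lim_c1r];
    comparing the two gives [expmC]. *)
Let lim_c1l i j t : limn (pseries (c 1 i j) t) = (B *m expm t) i j.
Proof.
apply/cvg_lim => //; rewrite mxE.
rewrite (_ : pseries (c 1 i j) t =
    fun N => \sum_l B i l * pseries (c 0 l j) t N).
  apply: cvg_sumR => l; apply: cvgMl_tmp; rewrite mxE; exact: cvg_c.
apply/funext => N; rewrite /pseries /series /=.
under [RHS]eq_bigr do rewrite mulr_sumr.
rewrite exchange_big /=; apply: eq_bigr => k _.
rewrite /c addn1 addn0 exprS mxE !mulr_suml; apply: eq_bigr => l _.
by rewrite !mulrA.
Qed.

Let lim_c1r i j t : limn (pseries (c 1 i j) t) = (expm t *m B) i j.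
Proof.
apply/cvg_lim => //; rewrite mxE.
rewrite (_ : pseries (c 1 i j) t =
    fun N => \sum_l pseries (c 0 i l) t N * B l j).
  apply: cvg_sumR => l; apply: cvgMr_tmp; rewrite mxE; exact: cvg_c.
apply/funext => N; rewrite /pseries /series /=.
under [RHS]eq_bigr do rewrite mulr_suml.
rewrite exchange_big /=; apply: eq_bigr => k _.
rewrite /c addn1 addn0 exprSr mxE !mulr_suml; apply: eq_bigr => l _.
by ring.
Qed.

Lemma mderive_expm t : mderive expm (expm t *m B) t.
Proof. by move=> i j; rewrite -lim_c1r; exact: is_derive_expm. Qed.

Lemma expmC t : expm t *m B = B *m expm t.
Proof. by apply/matrixP => i j; rewrite -lim_c1r lim_c1l. Qed.

Lemma expm0 : expm 0 = 1%:M.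
Proof.
apply/matrixP => i j; rewrite mxE; apply/cvg_lim => //.
rewrite -(cvg_shiftS _) /=.
rewrite (_ : (fun N => _) = cst ((1%:M : 'M[R]_n) i j)); first exact: cvg_cst.
apply/funext => N; rewrite /pseries /series /= big_nat_recl//=.
rewrite /c addn0 expr0 fact0 divr1 mulr1 big1 ?addr0// => k _.
by rewrite expr0n mulr0.
Qed.

Lemma mderive_expmN t : mderive (fun s => expm (- s)) (- (expm (- t) *m B)) t.
Proof. exact/mderiveN/mderive_expm. Qed.

(** The only instance of the group law in use, so a vanishing derivative replaces the Cauchy product
    of series. Accordingly E(t - s) is later kept as the product of E(t) and E(- s). *)
Lemma expmNK t : expm (- t) *m expm t = 1%:M.
Proof.
suff -> : expm (- t) *m expm t = expm (- 0) *m expm 0.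
  by rewrite oppr0 expm0 mul1mx.
apply: (mderive_cstE (F := fun t => expm (- t) *m expm t)) => {}t.
have := mderive_mul (mderive_expmN t) (mderive_expm t).
by rewrite (expmC t) mulNmx -!mulmxA addNr.
Qed.

Lemma expmKN t : expm t *m expm (- t) = 1%:M.
Proof. by rewrite -{1}(opprK t) expmNK. Qed.

End matrix_exponential.

Section expm_more.
Context {R : realType} {n : nat}.
Variable B : 'M[R]_n.

Lemma expm_fix p (v : 'M[R]_(n, p)) t : B *m v = 0 -> expm B t *m v = v.
Proof.
move=> Bv; suff -> : expm B t *m v = expm B 0 *m v by rewrite expm0 mul1mx.
apply: (mderive_cstE (F := fun t => expm B t *m v)) => {}t.
have := mderive_mul (mderive_expm B t) (mderive_cst v t).
by rewrite mulmx0 addr0 -mulmxA Bv mulmx0.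
Qed.

End expm_more.

(** * Decay of the flow of a Hurwitz matrix *)

Section scalar_decay.
Context {R : realType}.

(** Gronwall with a vanishing forcing: once |e| <= c eps / 2, the function (h - eps / 2) exp(ct) no
    longer increases, so h exceeds eps / 2 by at most a multiple of exp(- ct). *)
Lemma differential_inequality_cvg0 (h dh e : R -> R) (c : R) : 0 < c ->
  (forall t : R, 0 <= h t) -> (forall t : R, is_derive t (1 : R) h (dh t)) ->
  (forall t, dh t <= - c * h t + e t) -> e t @[t --> +oo] --> (0 : R) ->
  h t @[t --> +oo] --> (0 : R).
Proof.
move=> c0 h0 hd dhle e0; apply/cvgrPdist_le => eps eps0.
have ce0 : 0 < c * (eps / 2) by rewrite mulr_gt0// divr_gt0.
have [T [_ HT]] : \forall t \near +oo, `|0 - e t| <= c * (eps / 2).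
  by move/cvgrPdist_le : e0; apply.
pose g (t : R) := (h t - eps / 2) * expR (c * t).
pose dg (t : R) := (dh t + c * h t - c * (eps / 2)) * expR (c * t).
have gd (t : R) : is_derive t (1 : R) g (dg t).
  have h1 : is_derive t (1 : R) (fun t : R => h t - eps / 2) (dh t).
    by apply: is_derive_eq; rewrite subr0.
  have h2 : is_derive t (1 : R) (fun t : R => c * t) c.
    rewrite -[X in is_derive _ _ _ X]mulr1.
    exact: (is_deriveZ c (is_derive_id t (1 : R))).
  have h3 := is_derive1_comp (is_derive_expR (c * t)) h2.
  have -> : dg t = (h t - eps / 2) *: (expR (c * t) * c) + expR (c * t) *: dh t.
    by rewrite /dg /GRing.scale /=; ring.
  exact: is_deriveM h1 h3.
have gnincr : forall x y : R, T <= x -> x <= y -> g y <= g x.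
  apply: ler0_derive1_nincry => [x _|x|].
  - by have [] := gd x.
  - rewrite in_itv/= andbT => /HT; rewrite sub0r normrN => /ler_normlP[_ ex].
    rewrite derive1E; have [_ ->] := gd x.
    rewrite /dg mulr_le0_ge0 ?expR_ge0// subr_le0.
    have := dhle x; lra.
  - by apply: derivable_within_continuous => x _; have [] := gd x.
near=> t.
have tT : T <= t by near: t; apply: nbhs_pinfty_ge; exact: num_real.
have tG : `|g T| / (c * (eps / 2)) <= t.
  by near: t; apply: nbhs_pinfty_ge; exact: num_real.
rewrite sub0r normrN ger0_norm//.
have ct : 0 < expR (c * t) by exact: expR_gt0.
have gt : g t <= `|g T| by rewrite (le_trans (gnincr _ _ (lexx T) tT))// ler_norm.
(* This linear bound on the exponential suffices, since [tG] already makes eps / 2 * (c t) at least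
   |g T|. *)
have et : c * t <= expR (c * t).
  by rewrite (le_trans _ (expR_ge1Dx _))// lerDr.
have gT : `|g T| <= eps / 2 * expR (c * t).
  move: tG; rewrite ler_pdivrMr// => /le_trans; apply.
  rewrite [leLHS](_ : _ = eps / 2 * (c * t)); last by ring.
  by rewrite ler_wpM2l// divr_ge0// ltW.
have := le_trans gt gT; rewrite /g ler_pM2r//; lra.
Unshelve. all: by end_near. Qed.

Lemma sqr_cvg0 (f h : R -> R) : (forall t, f t ^+ 2 <= h t) ->
  h t @[t --> +oo] --> (0 : R) -> f t @[t --> +oo] --> (0 : R).
Proof.
move=> fh h0; apply/cvgrPdist_le => eps eps0.
move/cvgrPdist_le : h0 => /(_ (eps ^+ 2) (exprn_gt0 _ eps0)).
apply: filterS => t; rewrite !sub0r !normrN => ht.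
rewrite -(@ler_pXn2r _ 2)//; rewrite ?nnegrE ?normr_ge0 ?(ltW eps0)//.
rewrite -normrX ger0_norm ?sqr_ge0// (le_trans (fh t))//.
exact: le_trans (ler_norm _) ht.
Qed.

End scalar_decay.

Section matrix_decay.
Context {R : realType}.

Definition tends0 m n (F : R -> 'M[R]_(m, n)) :=
  forall i j, F t i j @[t --> +oo] --> (0 : R).

Lemma tends0_mulr m n p (F : R -> 'M[R]_(m, n)) (X : 'M[R]_(n, p)) :
  tends0 F -> tends0 (fun t => F t *m X).
Proof.
move=> F0 i j; under eq_fun do rewrite mxE.
have H : \sum_k F t i k * X k j @[t --> +oo] --> \sum_(k < n) 0 * X k j.
  by apply: cvg_sumR => k; apply: cvgMr_tmp; exact: F0.
by rewrite big1 in H => // k _; rewrite mul0r.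
Qed.

Lemma tends0_mull m n p (F : R -> 'M[R]_(m, n)) (X : 'M[R]_(p, m)) :
  tends0 F -> tends0 (fun t => X *m F t).
Proof.
move=> F0 i j; under eq_fun do rewrite mxE.
have H : \sum_k X i k * F t k j @[t --> +oo] --> \sum_(k < m) X i k * 0.
  by apply: cvg_sumR => k; apply: cvgMl_tmp; exact: F0.
by rewrite big1 in H => // k _; rewrite mulr0.
Qed.

Lemma tends0_conj m n (F : R -> 'M[R]_(m, n)) (S : 'M[R]_n) :
  tends0 F -> tends0 (fun t => F t *m S *m (F t)^T).
Proof.
move=> F0 i j; under eq_fun do rewrite mxE.
have H : \sum_k (F t *m S) i k * ((F t)^T k j) @[t --> +oo]
    --> \sum_(k < n) (0 * 0 : R).
  apply: cvg_sumR => k; apply: cvgM; first exact: tends0_mulr.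
  by under eq_fun do rewrite mxE; exact: F0.
by rewrite big1 in H => // k _; rewrite mul0r.
Qed.

(* E(t) (X + iY) solves the complex equation F' = z F + E(t) (B - z) (X + iY)
   with z = a + ib, and |F|^2 obeys a real differential inequality. *)
Lemma decay_step n p (B : 'M[R]_n) (X Y : 'M[R]_(n, p)) (a b : R) : a < 0 ->
  tends0 (fun t => expm B t *m (B *m X - a *: X + b *: Y)) ->
  tends0 (fun t => expm B t *m (B *m Y - a *: Y - b *: X)) ->
  tends0 (fun t => expm B t *m X) /\ tends0 (fun t => expm B t *m Y).
Proof.
move=> a0; set X' := _ + _; set Y' := _ - _ => X'0 Y'0.
suff H i j : (expm B t *m X) i j ^+ 2 + (expm B t *m Y) i j ^+ 2 @[t --> +oo]
    --> (0 : R).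
  by split=> i j; apply: (sqr_cvg0 _ (H i j)) => t;
    rewrite ?lerDl ?lerDr sqr_ge0.
pose f (t : R) := (expm B t *m X) i j; pose g (t : R) := (expm B t *m Y) i j.
pose f0 (t : R) := (expm B t *m X') i j; pose g0 (t : R) := (expm B t *m Y') i j.
have dE (V : 'M[R]_(n, p)) (t : R) :
    is_derive t (1 : R) (fun t : R => (expm B t *m V) i j) ((expm B t *m (B *m V)) i j).
  have := mderive_mul (mderive_expm B t) (mderive_cst V t).
  by rewrite mulmx0 addr0 -mulmxA; apply.
have BX (t : R) : (expm B t *m (B *m X)) i j = f0 t + a * f t - b * g t.
  rewrite /f0 /f /g /X' mulmxDr mulmxBr -!scalemxAr !mxE; ring.
have BY (t : R) : (expm B t *m (B *m Y)) i j = g0 t + a * g t + b * f t.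
  rewrite /g0 /f /g /Y' !mulmxBr -!scalemxAr !mxE; ring.
have fd (t : R) : is_derive t (1 : R) f (f0 t + a * f t - b * g t).
  by rewrite -BX; exact: dE.
have gd (t : R) : is_derive t (1 : R) g (g0 t + a * g t + b * f t).
  by rewrite -BY; exact: dE.
apply: (@differential_inequality_cvg0 _ (fun t => f t ^+ 2 + g t ^+ 2)
  (fun t => 2 * f t * (f0 t + a * f t - b * g t) +
            2 * g t * (g0 t + a * g t + b * f t))
  (fun t => (f0 t ^+ 2 + g0 t ^+ 2) / - a) (- a)).
- by rewrite oppr_gt0.
- by move=> t; rewrite addr_ge0 ?sqr_ge0.
- move=> t; apply: is_derive_eq.
  by rewrite /GRing.scale /=; ring.
- move=> t.
  (* In the derivative of f^2 + g^2 the rotation terms in [b] cancel, leaving 2 a (f^2 + g^2) plus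
     forcing. Young's inequality with weight [- a] spends half of the decay on the forcing, which
     leaves the rate [- a]. *)
  have amgm (x y : R) : 2 * x * y <= - a * x ^+ 2 + y ^+ 2 / - a.
    have : 0 <= (- a * x - y) ^+ 2 / - a.
      by rewrite divr_ge0 ?sqr_ge0// oppr_ge0 ltW.
    have -> : (- a * x - y) ^+ 2 / - a = - a * x ^+ 2 + y ^+ 2 / - a - 2 * x * y.
      by field; rewrite lt_eqF.
    by rewrite subr_ge0.
  have := amgm (f t) (f0 t); have := amgm (g t) (g0 t).
  rewrite mulrDl; nra.
- rewrite [X in _ --> X](_ : 0 = (0 * 0 + 0 * 0) / - a); last by ring.
  apply: cvgMr_tmp; under eq_fun do rewrite !expr2.
  by apply: cvgD; apply: cvgM; [exact: X'0..|exact: Y'0|exact: Y'0].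
Qed.

Let RC := real_complex R.

Let shift n p (B : 'M[R]_n) (Z : 'M[R[i]]_(n, p)) (z : R[i]) :=
  map_mx RC B *m Z - z *: Z.

Let Re_shift n p (B : 'M[R]_n) (Z : 'M[R[i]]_(n, p)) z :
  map_mx (@complex.Re R) (shift B Z z) =
  B *m map_mx (@complex.Re R) Z - complex.Re z *: map_mx (@complex.Re R) Z
  + complex.Im z *: map_mx (@complex.Im R) Z.
Proof.
apply/matrixP => i j; rewrite !mxE raddfB raddf_sum /=.
rewrite -addrA; congr (_ + _).
  apply: eq_bigr => k _; rewrite !mxE.
  by case: (Z k j) => x y; rewrite /= mul0r subr0.
by case: z => a b; case: (Z i j) => x y /=; ring.
Qed.

Let Im_shift n p (B : 'M[R]_n) (Z : 'M[R[i]]_(n, p)) z :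
  map_mx (@complex.Im R) (shift B Z z) =
  B *m map_mx (@complex.Im R) Z - complex.Re z *: map_mx (@complex.Im R) Z
  - complex.Im z *: map_mx (@complex.Re R) Z.
Proof.
apply/matrixP => i j; rewrite !mxE raddfB raddf_sum /=.
rewrite -addrA; congr (_ + _).
  apply: eq_bigr => k _; rewrite !mxE.
  by case: (Z k j) => x y; rewrite /= mul0r addr0.
by case: z => a b; case: (Z i j) => x y /=; ring.
Qed.

(** If the product of the factors B - z over [r] kills Z, then (B - z) Z is killed by one factor
    fewer, so it decays by induction and [decay_step] passes the decay on to Z. The real and
    imaginary parts of [shift] are exactly the two hypotheses of [decay_step]. *)
Let decay_roots n p (B : 'M[R]_n) (r : seq R[i]) (Z : 'M[R[i]]_(n, p)) :
  (forall z, z \in r -> complex.Re z < 0) -> foldl (shift B) Z r = 0 ->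
  tends0 (fun t => expm B t *m map_mx (@complex.Re R) Z) /\
  tends0 (fun t => expm B t *m map_mx (@complex.Im R) Z).
Proof.
elim: r Z => [|z r IH] Z rneg /=.
  move=> ->; rewrite (_ : map_mx _ 0 = 0 :> 'M[R]_(n, p)); last first.
    by apply/matrixP => i j; rewrite !mxE.
  rewrite (_ : map_mx _ 0 = 0 :> 'M[R]_(n, p)); last first.
    by apply/matrixP => i j; rewrite !mxE.
  split=> i j; under eq_fun do rewrite mulmx0 mxE; exact: cvg_cst.
move=> /IH[|Re0 Im0].
  by move=> w wr; apply: rneg; rewrite inE wr orbT.
apply: (@decay_step _ _ _ _ _ (complex.Re z) (complex.Im z)).
- by apply: rneg; rewrite inE eqxx.
- by rewrite -Re_shift.
- by rewrite -Im_shift.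
Qed.

Let hurwitz_annihilator n (M : 'M[R]_n) : hurwitz M ->
  exists2 r : seq R[i], (forall z, z \in r -> complex.Re z < 0) &
    foldl (shift M) 1%:M r = 0.
Proof.
(* [horner_mx] and Cayley-Hamilton live on matrices of positive size, so size 0 is treated apart. *)
case: n M => [|n] M hM; first by exists [::] => //; rewrite [LHS]thinmx0.
pose Mc := map_mx RC M.
have [r rE] := closed_field_poly_normal (char_poly Mc).
exists r.
  move=> z zr; apply: hM; rewrite eigenvalue_root_char rE.
  by rewrite (monicP (char_poly_monic _)) scale1r root_prod_XsubC.
have foldlE (Z : 'M[R[i]]_n.+1) s :
    foldl (shift M) Z s = horner_mx Mc (\prod_(z <- s) ('X - z%:P)) *m Z.
  elim: s Z => [|z s IH] Z; first by rewrite big_nil rmorph1 mul1mx.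
  rewrite /= IH big_cons mulrC rmorphM /= -[in RHS]mulmxE -mulmxA.
  congr (_ *m _); rewrite rmorphB /= horner_mx_X horner_mx_C mulmxBl.
  by rewrite mul_scalar_mx.
rewrite foldlE -[\prod_(z <- r) _]scale1r -(monicP (char_poly_monic Mc)) -rE.
by rewrite Cayley_Hamilton mul0mx.
Qed.

Lemma hurwitz_decay n (M : 'M[R]_n) : hurwitz M -> tends0 (expm M).
Proof.
move=> /hurwitz_annihilator[r rneg r0].
have [+ _] := decay_roots rneg r0.
rewrite (_ : map_mx _ 1%:M = 1%:M :> 'M[R]_n).
  by under eq_fun do rewrite mulmx1.
by apply/matrixP => i j; rewrite !mxE; case: (i == j).
Qed.

(** [shift] by the block matrix keeps the shape [col_mx 0 Z] and acts on Z as [shift M], so the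
    annihilator of [M] also kills [col_mx 0 1%:M]. *)
Lemma hurwitz_block_decay k l (N : 'M[R]_(l, k)) (M : 'M[R]_l) : hurwitz M ->
  tends0 (fun t => expm (block_mx 0 0 N M) t *m col_mx 0 1%:M).
Proof.
move=> /hurwitz_annihilator[r rneg r0].
have E s (Z : 'M[R[i]]_l) : foldl (shift (block_mx (0 : 'M[R]_k) 0 N M)) (col_mx 0 Z) s =
    col_mx 0 (foldl (shift M) Z s).
  elim: s Z => //= z s IH Z; rewrite -IH; congr (foldl _ _ _).
  rewrite /shift map_block_mx mul_block_col !mulmx0 !map_mx0 mul0mx add0r.
  by rewrite scale_col_mx opp_col_mx add_col_mx scaler0 subr0 add0r.
have := E r 1%:M; rewrite r0 col_mx0 => /(decay_roots rneg)[+ _].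
rewrite (_ : map_mx _ (col_mx _ _) = col_mx 0 1%:M :> 'M[R]_(k + l, l))//.
rewrite map_col_mx; congr col_mx; apply/matrixP => i j; rewrite !mxE//.
by case: (i == j).
Qed.

End matrix_decay.

(** * Positive definite matrices and Schur complements *)

Section linear_algebra.
Context {R : realType}.

Lemma unitmx_ker0 (F : fieldType) n (A : 'M[F]_n) :
  (forall v : 'rV_n, v *m A = 0 -> v = 0) -> A \in unitmx.
Proof.
move=> A0; rewrite -row_free_unit -kermx_eq0; apply/rowV0P => v.
by move=> /sub_kermxP; exact: A0.
Qed.

Lemma posdef_unit n (S : 'M[R]_n) : posdef S -> S \in unitmx.
Proof.
move=> [Ssym Spos]; apply: unitmx_ker0 => v vS.
apply/eqP; rewrite -trmx_eq0; apply/negPn/negP => /Spos.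
by rewrite trmxK vS mul0mx mxE ltxx.
Qed.

Section schur.
Variables (k l : nat) (S : 'M[R]_(k + l)).
Hypothesis S_pos : posdef S.

Let Ssym : S^T = S. Proof. by case: S_pos. Qed.

Lemma posdef_ursub : ursubmx S = (dlsubmx S)^T.
Proof. by rewrite trmx_dlsub Ssym. Qed.

Lemma posdef_ulsub : posdef (ulsubmx S).
Proof.
split=> [|v v0]; first by rewrite trmx_ulsub Ssym.
have : col_mx v (0 : 'cV_l) != 0.
  by apply: contraNneq v0; rewrite -col_mx0 => /eq_col_mx[->].
move=> /(proj2 S_pos); rewrite -{1}(submxK S) tr_col_mx mul_row_block.
by rewrite mul_row_col !trmx0 !mul0mx !addr0 mulmx0 addr0.
Qed.

Let S11 := ulsubmx S.

Let S11_unit : S11 \in unitmx.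
Proof. exact/posdef_unit/posdef_ulsub. Qed.

Definition schur := drsubmx S - dlsubmx S *m invmx S11 *m ursubmx S.

Definition schur_col : 'M[R]_(k + l, l) :=
  col_mx (- (dlsubmx S *m invmx S11)^T) 1%:M.

Lemma tr_dlsub_inv : (dlsubmx S *m invmx S11)^T = invmx S11 *m ursubmx S.
Proof.
rewrite trmx_mul -posdef_ursub trmx_inv /S11.
by have [-> _] := posdef_ulsub.
Qed.

Lemma mul_schur_col : S *m schur_col = col_mx 0 schur.
Proof.
rewrite /schur_col tr_dlsub_inv -{1}(submxK S) mul_block_col !mulmxN !mulmx1.
by rewrite mulKVmx// addNr mulmxA addrC.
Qed.

(** By [mul_schur_col], the quadratic form of the Schur complement at v is that of S at
    [schur_col *m v], which is nonzero because its lower block is v. *)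
Lemma posdef_schur : posdef schur.
Proof.
split.
  rewrite /schur linearB /= trmx_drsub Ssym !trmx_mul posdef_ursub trmxK.
  rewrite trmx_inv; have [-> _] := posdef_ulsub.
  by rewrite mulmxA.
move=> v v0; have : schur_col *m v != 0.
  apply: contraNneq v0; rewrite /schur_col mul_col_mx mul1mx -col_mx0.
  by move=> /eq_col_mx[_ ->].
move=> /(proj2 S_pos); rewrite -mulmxA (mulmxA S) mul_schur_col !mul_col_mx.
by rewrite mul0mx mul1mx tr_col_mx mul_row_col mulmx0 add0r mulmxA.
Qed.

End schur.

(** Peel off a 1 by 1 pivot and factor the Schur complement by induction. The factor serves to
    realise N(m, S) as the law of m + L g with g standard normal. *)
Lemma cholesky n (S : 'M[R]_n) : posdef S -> exists L : 'M[R]_n, L *m L^T = S.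
Proof.
elim: n S => [|n IH] S Spos.
  by exists 0; apply/matrixP => -[].
move: S Spos; rewrite -[n.+1]/(1 + n)%N => S Spos.
have [L' L'E] := IH _ (posdef_schur Spos).
pose a := ulsubmx S 0 0.
have S11E : ulsubmx S = a%:M by rewrite [LHS]mx11_scalar.
have a0 : 0 < a.
  have := (proj2 (posdef_ulsub Spos)) 1%:M.
  rewrite trmx1 mul1mx mulmx1; apply.
  by apply/eqP => /matrixP/(_ 0 0)/eqP; rewrite !mxE oner_eq0.
exists (block_mx (Num.sqrt a)%:M 0 ((Num.sqrt a)^-1 *: dlsubmx S) L').
have sa : Num.sqrt a * Num.sqrt a = a by rewrite -expr2 sqr_sqrtr// ltW.
have sa0 : Num.sqrt a != 0 by rewrite gt_eqF// sqrtr_gt0.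
rewrite tr_block_mx mulmx_block trmx0 !mulmx0 !mul0mx !addr0.
rewrite -[RHS]submxK; congr block_mx.
- by rewrite tr_scalar_mx -scalar_mxM sa.
- rewrite linearZ /= -posdef_ursub// mul_scalar_mx scalerA mulfV//.
  by rewrite scale1r.
- by rewrite tr_scalar_mx mul_mx_scalar scalerA mulfV// scale1r.
- rewrite L'E /schur S11E invmx_scalar mul_mx_scalar linearZ /=.
  rewrite -posdef_ursub// -scalemxAl -scalemxAr scalerA -invfM sa.
  by rewrite -scalemxAl addrC subrK.
Qed.

(** * The conditional covariance and the skew-symmetry criterion *)

Section conditional_covariance.
Variables (k l p : nat) (M : 'M[R]_(k + l)) (C : 'M[R]_(k + l, p)).
Variables (Sigma : 'M[R]_(k + l)) (alpha : 'M[R]_(l, k)).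
Hypothesis hSigma : lyapunov_solution M C Sigma.

Let A := C *m C^T.
Let J := 2^-1 *: (M *m Sigma - Sigma *m M^T).
Let pr : 'M[R]_(l, k + l) := row_mx alpha 1%:M.

Let Sigma_pos : posdef Sigma. Proof. by case: hSigma. Qed.
Let Sigma_sym : Sigma^T = Sigma. Proof. by case: Sigma_pos. Qed.

Lemma trmx_mul_cov : (M *m Sigma)^T = Sigma *m M^T.
Proof. by rewrite trmx_mul Sigma_sym. Qed.

(** [J] is the skew part of M Sigma by definition, and the Lyapunov equation makes [- A] its
    symmetric part. *)
Lemma JBA : J - A = M *m Sigma.
Proof.
have h : A = - 2^-1 *: (M *m Sigma + Sigma *m M^T).
  rewrite (proj2 hSigma) scalerA (_ : - 2^-1 * - 2 = 1 :> R) ?scale1r//.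
  by field.
rewrite h /J scaleNr opprK -scalerDr addrACA [- _ + _]addrC subrr addr0.
by rewrite scalerDr -scalerDl (_ : 2^-1 + 2^-1 = 1 :> R) ?scale1r//; field.
Qed.

Lemma drift_matrix : (J - A) *m invmx Sigma = M.
Proof. by rewrite JBA mulmxK// posdef_unit. Qed.

Let tr_J : J^T = - J.
Proof.
rewrite /J linearZ /= linearB /= trmx_mul_cov trmx_mul Sigma_sym trmxK.
by rewrite -scalerN opprB.
Qed.

Let tr_A : A^T = A. Proof. by rewrite /A trmx_mul trmxK. Qed.

Let hatM := alpha *m ursubmx M + drsubmx M.
Let G := (alpha + dlsubmx Sigma *m invmx (ulsubmx Sigma)) *m
  ((ulsubmx J + ulsubmx A) *m alpha^T + (ursubmx J + ursubmx A)).

Lemma hatME : pr *m M *m col_mx 0 1%:M = hatM.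
Proof.
by rewrite -{1}(submxK M) mul_row_block mul_row_col mulmx0 mulmx1 !mul1mx add0r.
Qed.

Lemma schur_lyapunovP :
  hatM *m schur Sigma + schur Sigma *m hatM^T =
    (- 2) *: ((pr *m C) *m (pr *m C)^T) <-> skew_symmetric G.
Proof.
pose q : 'M[R]_(k + l, l) :=
  col_mx (alpha + dlsubmx Sigma *m invmx (ulsubmx Sigma))^T 0.
pose X := M *m Sigma; pose Z := pr *m X *m q.
have eE : schur_col Sigma = pr^T - q.
  rewrite /schur_col /pr /q tr_row_mx trmx1 opp_col_mx add_col_mx oppr0 addr0.
  by congr col_mx; rewrite linearD /= opprD addrA subrr add0r.
have hatMS : hatM *m schur Sigma = pr *m X *m pr^T - Z.
  rewrite -hatME -[in LHS]mulmxA mul_col_mx mul0mx mul1mx -mul_schur_col//.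
  by rewrite eE mulmxA -(mulmxA pr M) mulmxBr.
have Shat : schur Sigma *m hatM^T = (hatM *m schur Sigma)^T.
  by rewrite trmx_mul; have [-> _] := posdef_schur Sigma_pos.
have ZG : Z^T = - G.
  rewrite /Z /X -JBA trmx_mul /q tr_col_mx trmx0 trmxK trmx_mul linearB /=.
  rewrite tr_J tr_A -opprD mulNmx mulmxN; congr (- _).
  rewrite -[in LHS](submxK J) -[in LHS](submxK A) add_block_mx /pr tr_row_mx.
  by rewrite trmx1 mul_block_col !mulmx1 mul_row_col mul0mx addr0.
have XX : X + X^T = (- 2) *: (C *m C^T).
  by rewrite /X trmx_mul_cov; case: hSigma.
(* Adding the transpose turns pr X pr^T into pr (X + X^T) pr^T, which is the right-hand side of the
   equation; what remains is Z + Z^T = 0, where Z^T = - G. *)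
rewrite Shat hatMS linearB /= addrACA.
have -> : pr *m X *m pr^T + (pr *m X *m pr^T)^T = pr *m (X + X^T) *m pr^T.
  by rewrite !trmx_mul trmxK mulmxDr mulmxDl !mulmxA.
rewrite XX -scalemxAr -scalemxAl [(pr *m C)^T]trmx_mul !mulmxA -opprD ZG.
have -> : Z = - G^T by rewrite -(trmxK Z) ZG linearN.
rewrite -opprD opprK /skew_symmetric; split.
  rewrite -[X in _ = X -> _]addr0 => /addrI/eqP; rewrite addr_eq0.
  by move=> /eqP.
by move=> ->; rewrite addNr addr0.
Qed.

End conditional_covariance.
End linear_algebra.

(** * Lyapunov equations *)

Section lyapunov.
Context {R : realType}.

Section stable.
Variables (n : nat) (M : 'M[R]_n).
Hypothesis M_stable : tends0 (expm M).

Let F (S : 'M[R]_n) (t : R) := expm M t *m S *m (expm M t)^T.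

Let F_deriv S t : mderive (F S) (F (M *m S + S *m M^T) t) t.
Proof.
have := mderive_mul (mderive_mul (mderive_expm M t) (mderive_cst S t))
  (mderive_tr (mderive_expm M t)).
rewrite mulmx0 addr0 trmx_mul /F mulmxDr mulmxDl.
by rewrite !mulmxA.
Qed.

Let F0 S : F S 0 = S.
Proof. by rewrite /F expm0 mul1mx trmx1 mulmx1. Qed.

Let F_cvg0 S : tends0 (F S).
Proof. exact: tends0_conj. Qed.

(** The equation makes E(t) S E(t)^T constant in t, while stability sends it to 0. *)
Lemma sylvester_inj (S : 'M[R]_n) : M *m S + S *m M^T = 0 -> S = 0.
Proof.
move=> S0; apply/matrixP => i j; rewrite mxE.
have FE t : F S t i j = S i j.
  suff -> : F S t = F S 0 by rewrite F0.
  apply: (mderive_cstE (F := F S)) => s.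
  by have := F_deriv S s; rewrite S0 /F mulmx0 mul0mx.
have := F_cvg0 S i j; under eq_fun do rewrite FE.
by move=> /(cvg_unique _ (cvg_cst _)) => ->.
Qed.

(** An injective endomorphism of a finite-dimensional space is onto; no integral formula for the
    solution is needed. *)
Lemma sylvester_surj (N : 'M[R]_n) : exists S : 'M[R]_n, M *m S + S *m M^T = N.
Proof.
pose f (S : 'M[R]_n) := M *m S + S *m M^T.
have flin : linear f.
  move=> a S T; rewrite /f mulmxDr mulmxDl -scalemxAr -scalemxAl scalerDr.
  by rewrite addrACA.
pose fL : {linear 'M[R]_n -> 'M[R]_n} :=
  HB.pack f (GRing.isLinear.Build _ _ _ _ f flin).
have fu : lin_mx fL \in unitmx.
  apply: unitmx_ker0 => v vf.
  suff : vec_mx v = 0 by move=> /(congr1 mxvec); rewrite vec_mxK linear0.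
  apply: sylvester_inj; rewrite -[LHS]/(fL (vec_mx v)).
  by apply: (can_inj mxvecK); rewrite -mul_vec_lin vec_mxK vf linear0.
exists (vec_mx (mxvec N *m invmx (lin_mx fL))).
rewrite -[LHS]/(fL (vec_mx _)).
by apply: (can_inj mxvecK); rewrite -mul_vec_lin vec_mxK mulmxKV.
Qed.

Lemma lyapunov_uniq (N S T : 'M[R]_n) : M *m S + S *m M^T = N ->
  M *m T + T *m M^T = N -> S = T.
Proof.
move=> SN TN; apply/eqP; rewrite -subr_eq0; apply/eqP/sylvester_inj.
by rewrite mulmxBr mulmxBl addrACA -opprD SN TN subrr.
Qed.

Lemma stable_unit : M \in unitmx.
Proof.
apply: unitmx_ker0 => v vM; apply/rowP => i; rewrite mxE.
have FE t : (v *m expm M t) 0 i = v 0 i.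
  suff -> : v *m expm M t = v *m expm M 0 by rewrite expm0 mulmx1.
  apply: (mderive_cstE (F := fun t => v *m expm M t)) => s.
  have := mderive_mul (mderive_cst v s) (mderive_expm M s).
  by rewrite mul0mx add0r expmC mulmxA vM mul0mx.
have := tends0_mull v M_stable 0 i; under eq_fun do rewrite FE.
by move=> /(cvg_unique _ (cvg_cst _)) => ->.
Qed.

Section positive.
Variables (p : nat) (C : 'M[R]_(n, p)) (S : 'M[R]_n).
Hypothesis S_eq : M *m S + S *m M^T = (- 2) *: (C *m C^T).

Lemma lyapunov_sym : S^T = S.
Proof.
apply: (lyapunov_uniq (N := (- 2) *: (C *m C^T))) => //.
rewrite -[RHS](trmxK) linearZ /= trmx_mul trmxK -S_eq.
by rewrite linearD /= !trmx_mul trmxK addrC.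
Qed.

Let norm2_ge0 m (v : 'cV[R]_m) : 0 <= (v^T *m v) 0 0.
Proof. by rewrite mxE sumr_ge0// => i _; rewrite mxE -expr2 sqr_ge0. Qed.

(** Along the flow, the form v^T E(t) S E(t)^T v has derivative - 2 |C^T E(t)^T v|^2 and tends to 0,
    so its initial value is nonnegative. *)
Lemma lyapunov_ge0 (v : 'cV[R]_n) : 0 <= (v^T *m S *m v) 0 0.
Proof.
pose g t := (v^T *m F S t *m v) 0 0.
have g0 : g 0 = (v^T *m S *m v) 0 0 by rewrite /g F0.
have gd t : is_derive t (1 : R) g ((v^T *m F (M *m S + S *m M^T) t *m v) 0 0).
  have := mderive_mul (mderive_mul (mderive_cst v^T t) (F_deriv S t))
    (mderive_cst v t).
  by rewrite mul0mx add0r mulmx0 addr0; exact.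
have dgle t : (v^T *m F (M *m S + S *m M^T) t *m v) 0 0 <= 0.
  rewrite S_eq /F -scalemxAr -scalemxAl -scalemxAr -scalemxAl mxE.
  rewrite mulNr oppr_le0 mulr_ge0//.
  have -> : v^T *m (expm M t *m (C *m C^T) *m (expm M t)^T) *m v =
      (C^T *m (expm M t)^T *m v)^T *m (C^T *m (expm M t)^T *m v).
    by rewrite !trmx_mul !trmxK !mulmxA.
  exact: norm2_ge0.
have gnincr : forall x y : R, 0 <= x -> x <= y -> g y <= g x.
  apply: ler0_derive1_nincry => [x _|x _|].
  - by have [] := gd x.
  - by rewrite derive1E; have [_ ->] := gd x.
  - by apply: derivable_within_continuous => x _; have [] := gd x.
have gcvg : g t @[t --> +oo] --> (0 : R).
  exact: (tends0_mulr v (tends0_mull v^T (@F_cvg0 S)) 0 0).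
rewrite -g0; apply: (cvgr_to_le gcvg).
near=> t; apply: gnincr => //; near: t; apply: nbhs_pinfty_ge; exact: num_real.
Unshelve. all: by end_near. Qed.

(** The equality case of Cauchy-Schwarz: when v^T S v = 0, the form at v + a u is 2 a u^T S v + a^2
    u^T S u, and its nonnegativity for all a forces u^T S v = 0. The choice u = S v concludes. *)
Lemma lyapunov_ker (v : 'cV[R]_n) : (v^T *m S *m v) 0 0 = 0 -> S *m v = 0.
Proof.
move=> v0.
have pol (u : 'cV[R]_n) (a : R) :
    0 <= 2 * a * (u^T *m S *m v) 0 0 + a ^+ 2 * (u^T *m S *m u) 0 0.
  have := lyapunov_ge0 (v + a *: u).
  have -> : (v + a *: u)^T *m S *m (v + a *: u) = v^T *m S *m v +
     a *: (v^T *m S *m u) + a *: (u^T *m S *m v) + a ^+ 2 *: (u^T *m S *m u).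
    rewrite [(v + _)^T]linearD /= [(a *: u)^T]linearZ /= mulmxDl -scalemxAl.
    rewrite mulmxDl !mulmxDr -!scalemxAl -!scalemxAr.
    by rewrite scalerA -expr2 !addrA.
  have e1 (X Y : 'M[R]_1) : (X + Y) 0 0 = X 0 0 + Y 0 0 by rewrite mxE.
  have e2 (b : R) (X : 'M[R]_1) : (b *: X) 0 0 = b * X 0 0 by rewrite mxE.
  rewrite !e1 !e2 v0 add0r.
  have -> : (v^T *m S *m u) 0 0 = (u^T *m S *m v) 0 0.
    rewrite -[RHS](mxE trmx_key (fun i j => _ j i)) -/(trmx _) !trmx_mul trmxK.
    by rewrite lyapunov_sym mulmxA.
  by move=> h; lra.
pose u := S *m v; have u2 : (u^T *m S *m v) 0 0 = (u^T *m u) 0 0.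
  by rewrite /u mulmxA.
have u0 : (u^T *m u) 0 0 = 0.
  set x := (u^T *m u) 0 0; set y := (u^T *m S *m u) 0 0.
  have x0 : 0 <= x by exact: norm2_ge0.
  have y0 : 0 <= y by exact: lyapunov_ge0.
  have y10 : 0 < y + 1 by rewrite ltr_wpDl.
  (* The minimiser would be - x / y; the denominator y + 1 avoids a vanishing y and still makes the
     value negative unless x = 0. *)
  have := pol u (- x / (y + 1)); rewrite u2 -/x -/y.
  have -> : 2 * (- x / (y + 1)) * x + (- x / (y + 1)) ^+ 2 * y =
     - (x ^+ 2 * (y + 2) / (y + 1) ^+ 2) by field; rewrite gt_eqF.
  rewrite oppr_ge0 => xy; apply/eqP; rewrite -sqrf_eq0; apply/eqP/le_anti.
  rewrite sqr_ge0 andbT; move: xy; rewrite pmulr_lle0 ?invr_gt0 ?exprn_gt0//.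
  by rewrite pmulr_lle0// ltr_wpDl.
apply/matrixP => i j; rewrite (ord1 j) [RHS]mxE -/u.
move: u0; rewrite mxE => /eqP.
rewrite psumr_eq0 => [/allP/(_ i)|k _]; last by rewrite mxE -expr2 sqr_ge0.
by rewrite mem_index_enum mxE -expr2 sqrf_eq0 => /(_ isT)/eqP.
Qed.

(* A null vector of S stays null along the orbit of M^T, where C^T vanishes. *)
Lemma lyapunov_posdef : controllable M C -> posdef S.
Proof.
move=> MC; split; first exact: lyapunov_sym.
have kerS (v : 'cV[R]_n) : S *m v = 0 -> C^T *m v = 0 /\ S *m (M^T *m v) = 0.
  move=> Sv; have e := congr1 (mulmx^~ v) S_eq.
  rewrite /= mulmxDl -!mulmxA Sv mulmx0 add0r -scalemxAl -mulmxA in e.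
  have Cv : C^T *m v = 0.
    have : ((C^T *m v)^T *m (C^T *m v)) 0 0 = 0.
      have := congr1 (mulmx v^T) e.
      rewrite mulmxA -[v^T *m S]trmxK trmx_mul trmxK lyapunov_sym Sv trmx0 mul0mx.
      rewrite -scalemxAr => /esym/eqP; rewrite scaler_eq0 oppr_eq0 pnatr_eq0 /=.
      by move=> /eqP e'; rewrite trmx_mul trmxK -mulmxA e' mxE.
    rewrite mxE => /eqP; rewrite psumr_eq0 => [/allP H|k _]; last first.
      by rewrite mxE -expr2 sqr_ge0.
    apply/matrixP => i j; rewrite (ord1 j) [RHS]mxE; apply/eqP.
    by have := H i; rewrite mem_index_enum mxE -expr2 sqrf_eq0; exact.
  by rewrite e Cv mulmx0 scaler0.
move=> v v0; rewrite lt_neqAle lyapunov_ge0 andbT eq_sym.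
apply: contraNneq v0 => /lyapunov_ker Sv.
have kerj j : C^T *m ((M ^+ j)^T *m v) = 0.
  suff /kerS[] : S *m ((M ^+ j)^T *m v) = 0 by [].
  elim: j => [|j IH]; first by rewrite expr0 trmx1 mul1mx.
  rewrite exprSr -[M ^+ j * M]/(M ^+ j *m M) trmx_mul -mulmxA.
  by have [] := kerS _ IH.
have : v^T *m \mxrow_(j < n) (M ^+ j *m C) = 0.
  rewrite mul_mxrow; apply/eqP; rewrite -mxrow0; apply/eqP/eq_mxrow => j.
  by apply: (can_inj trmxK); rewrite !trmx_mul trmxK trmx0 -mulmxA kerj.
move: MC => /eqP; rewrite -/(row_free _) => MC.
by move=> /eqP; rewrite mulmx_free_eq0// trmx_eq0.
Qed.

End positive.
End stable.
End lyapunov.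

(** * Expectations of bounded functions *)

Section bounded_expectation.
Local Open Scope ring_scope.
Context {R : realType}.

(** Boundedness gives integrability under every probability at once, and the class is stable under
    sums, products and uniformly bounded limits. *)
Definition bounded_mfun d (T : measurableType d) (f : T -> R) :=
  measurable_fun setT f /\ exists M : R, forall x, `|f x| <= M.

Section bounded_mfun_theory.
Context d (T : measurableType d).
Implicit Types f g : T -> R.

Lemma bounded_mfun_cst (c : R) : bounded_mfun (fun _ : T => c).
Proof. by split; [exact: measurable_cst|exists `|c|]. Qed.

Lemma bounded_mfunD f g : bounded_mfun f -> bounded_mfun g ->
  bounded_mfun (fun x => f x + g x).
Proof.
move=> [mf [M fM]] [mg [N gN]]; split; first exact: measurable_funD.
by exists (M + N) => x; rewrite (le_trans (ler_normD _ _))// lerD.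
Qed.

Lemma bounded_mfunM f g : bounded_mfun f -> bounded_mfun g ->
  bounded_mfun (fun x => f x * g x).
Proof.
move=> [mf [M fM]] [mg [N gN]]; split; first exact: measurable_funM.
by exists (M * N) => x; rewrite normrM ler_pM.
Qed.

Lemma bounded_mfunZ (c : R) f : bounded_mfun f -> bounded_mfun (fun x => c * f x).
Proof. exact/bounded_mfunM/bounded_mfun_cst. Qed.

Lemma bounded_mfun_comp d' (T' : measurableType d') (X : T' -> T) f :
  measurable_fun setT X -> bounded_mfun f -> bounded_mfun (f \o X).
Proof.
move=> mX [mf [M fM]]; split; first exact: measurableT_comp.
by exists M => x; exact: fM.
Qed.

Lemma bounded_mfun_cos f : measurable_fun setT f -> bounded_mfun (cos \o f).
Proof.
move=> mf; split; last by exists 1 => x; rewrite /= ler_norml cos_geN1 cos_le1.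
by apply: measurableT_comp => //; apply: continuous_measurable_fun; exact: continuous_cos.
Qed.

Lemma bounded_mfun_sin f : measurable_fun setT f -> bounded_mfun (sin \o f).
Proof.
move=> mf; split; last by exists 1 => x; rewrite /= ler_norml sin_geN1 sin_le1.
by apply: measurableT_comp => //; apply: continuous_measurable_fun; exact: continuous_sin.
Qed.

Lemma bounded_mfun_indic (A : set T) : measurable A -> bounded_mfun (\1_A : T -> R).
Proof.
move=> mA; split; first exact: measurable_indic.
by exists 1 => x; rewrite indicE ger0_norm// lern1; case: (_ \in _).
Qed.

Lemma bounded_mfun_lim (F : nat -> T -> R) (f : T -> R) (M : R) :
  (forall n, measurable_fun setT (F n)) -> (forall n x, `|F n x| <= M) ->
  (forall x, F n x @[n --> \oo] --> f x) -> bounded_mfun f.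
Proof.
move=> mF FM Ff; split.
  by apply: (measurable_fun_cvg (h := F)) => // x _; exact: Ff.
exists M => x; apply: (cvgr_to_le (cvg_norm (Ff x))).
by near=> n; exact: FM.
Unshelve. all: by end_near. Qed.

End bounded_mfun_theory.

Lemma bounded_mfun_cosR : bounded_mfun (cos : R -> R).
Proof.
split; first by apply: continuous_measurable_fun; exact: continuous_cos.
by exists 1 => x; rewrite ler_norml cos_geN1 cos_le1.
Qed.

Lemma bounded_mfun_sinR : bounded_mfun (sin : R -> R).
Proof.
split; first by apply: continuous_measurable_fun; exact: continuous_sin.
by exists 1 => x; rewrite ler_norml sin_geN1 sin_le1.
Qed.

Section expectation.
Context d (T : measurableType d) (P : probability T R).
Implicit Types f g : T -> R.

Definition expect f : R := \int[P]_x f x.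

Lemma bounded_mfun_integrable f : bounded_mfun f -> P.-integrable setT (EFin \o f).
Proof.
move=> [mf [M fM]]; apply: measurable_bounded_integrable => //.
  by rewrite (le_lt_trans (probability_le1 _ _))// ltry.
exists M; split; first exact: num_real.
by move=> x Mx y _; exact: le_trans (fM y) (ltW Mx).
Qed.

Lemma expectE f : bounded_mfun f -> ((expect f)%:E = \int[P]_x (f x)%:E)%E.
Proof.
by move=> /bounded_mfun_integrable fi; rewrite /expect /Rintegral fineK//
  integrable_fin_num.
Qed.

Lemma expect_cst (c : R) : expect (fun=> c) = c.
Proof. by rewrite /expect Rintegral_cst//= probability_setT mulr1. Qed.

Lemma expectD f g : bounded_mfun f -> bounded_mfun g ->
  expect (fun x => f x + g x) = expect f + expect g.
Proof. by move=> hf hg; rewrite /expect RintegralD//; exact: bounded_mfun_integrable. Qed.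

Lemma expectZ (c : R) f : bounded_mfun f -> expect (fun x => c * f x) = c * expect f.
Proof. by move=> hf; rewrite /expect RintegralZl//; exact: bounded_mfun_integrable. Qed.

Lemma expect_indic (A : set T) : measurable A -> expect \1_A = fine (P A).
Proof. by move=> mA; rewrite /expect /Rintegral integral_indic// setIT. Qed.

Lemma ae_eq_expect f g : bounded_mfun f -> bounded_mfun g ->
  {ae P, forall x, f x = g x} -> expect f = expect g.
Proof.
move=> [mf _] [mg _] fg; rewrite /expect /Rintegral; congr fine.
apply: ae_eq_integral => //; try exact/measurable_EFinP.
by case: fg => N [mN N0 fgN]; exists N; split=> // x /= fgx; apply: fgN => /= fg;
  apply: fgx => _; rewrite fg.
Qed.

Lemma expect_lim (F : nat -> T -> R) (f : T -> R) (M : R) :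
  (forall n, measurable_fun setT (F n)) -> (forall n x, `|F n x| <= M) ->
  (forall x, F n x @[n --> \oo] --> f x) ->
  expect (F n) @[n --> \oo] --> expect f.
Proof.
move=> mF FM Ff; have [mf _] := bounded_mfun_lim mF FM Ff.
have hF n : bounded_mfun (F n) by split => //; exists M => x; exact: FM.
have hf := bounded_mfun_lim mF FM Ff.
suff : ((expect (F n))%:E @[n --> \oo] --> (expect f)%:E)%E by move=> /fine_cvgP[].
under eq_fun do rewrite (expectE (hF _)).
have cF x : (F n x)%:E @[n --> \oo] --> (f x)%:E.
  by apply: cvg_EFin; [exact: nearW|exact: Ff].
have eFM x n : (`|(F n x)%:E| <= M%:E)%E by rewrite lee_fin.
have [_ _] := @dominated_convergence _ _ _ P setT measurableT
  (fun n => EFin \o F n) (EFin \o f) (cst M%:E)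
  (fun n => proj2 (measurable_EFinP _ _) (mF n))
  (proj2 (measurable_EFinP _ _) mf)
  (aeW P (fun x _ => cF x))
  (bounded_mfun_integrable (@bounded_mfun_cst d T M))
  (aeW P (fun x n _ => eFM x n)).
by rewrite -expectE.
Qed.

End expectation.

Section induction_on_bounded_mfun.
Context d (T : measurableType d) (Q : (T -> R) -> Prop).
Hypothesis Q_indic : forall A, measurable A -> Q \1_A.
Hypothesis QD : forall f g, bounded_mfun f -> bounded_mfun g -> Q f -> Q g ->
  Q (fun x => f x + g x).
Hypothesis QZ : forall (c : R) f, bounded_mfun f -> Q f -> Q (fun x => c * f x).
Hypothesis Q_lim : forall (F : nat -> T -> R) (f : T -> R) (M : R),
  (forall n, bounded_mfun (F n)) -> (forall n x, `|F n x| <= M) ->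
  (forall x, F n x @[n --> \oo] --> f x) -> (forall n, Q (F n)) -> Q f.

Let Q0 : Q (fun=> 0).
Proof.
have -> : (fun=> 0) = (\1_set0 : T -> R) by apply/funext => x; rewrite indicE in_set0.
exact: Q_indic.
Qed.

Import HBNNSimple.

Let Q_nnsfun (f : {nnsfun T >-> R}) : Q f.
Proof.
have -> : (f : T -> R) = fun x =>
    \sum_(y <- finmap.enum_fset (fset_set (range f))) y * \1_(f @^-1` [set y]) x.
  by apply/funext => x; rewrite {1}fimfunE fsbig_finite.
suff : forall s : seq R,
    bounded_mfun (fun x => \sum_(y <- s) y * \1_(f @^-1` [set y]) x) /\
    Q (fun x => \sum_(y <- s) y * \1_(f @^-1` [set y]) x).
  by move=> /(_ (finmap.enum_fset (fset_set (range f))))[].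
elim=> [|y s [IHb IHQ]].
  under eq_fun do rewrite big_nil.
  by split; [exact: bounded_mfun_cst|exact: Q0].
under eq_fun do rewrite big_cons.
have b1 : bounded_mfun (\1_(f @^-1` [set y]) : T -> R).
  exact/bounded_mfun_indic/measurable_sfunP.
split; first by apply: bounded_mfunD => //; exact: bounded_mfunZ.
by apply: QD => //; [exact: bounded_mfunZ|apply: QZ => //];
  apply: Q_indic; exact: measurable_sfunP.
Qed.

(** Adding the bound makes f nonnegative, hence an increasing limit of simple functions below
    [M + M]; the constant is then subtracted as a multiple of [\1_setT]. *)
Lemma bounded_mfun_ind f : bounded_mfun f -> Q f.
Proof.
move=> [mf [M fM]].
have mfM : measurable_fun setT (EFin \o (fun x => f x + M)).
  by apply/measurable_EFinP; exact: measurable_funD.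
have f0 x : setT x -> (0 <= ((f x + M)%R)%:E)%E.
  by move=> _; rewrite lee_fin -lerBlDr sub0r; have /ler_normlP[] := fM x; rewrite lerNl.
have [g [gnd gcvg]] := approximation measurableT mfM f0.
have gle n x : `|g n x| <= M + M.
  rewrite ger0_norm//; have /fine_cvgP[_ gc] := gcvg x I.
  apply: (@le_trans _ _ (f x + M)).
    rewrite -(cvg_lim _ gc)//; apply: nondecreasing_cvgn_le; last exact: (cvgP _ gc).
    by move=> a b ab /=; have /lefP/(_ x) := gnd _ _ ab.
  by rewrite lerD2r; exact: le_trans (ler_norm _) (fM x).
have Qf : Q (fun x => f x + M).
  apply: (@Q_lim (fun n => g n) _ (M + M)) => //.
    by move=> n; split; [exact: measurable_funP|exists (M + M)].
  by move=> x; have /fine_cvgP[_] := gcvg x I.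
have -> : f = fun x => (f x + M) + - M * \1_setT x.
  by apply/funext => x; rewrite indicE in_setT mulr1 addrK.
apply: QD => //.
- by apply: bounded_mfunD; [split=> //; exists M|exact: bounded_mfun_cst].
- by apply: bounded_mfunZ; exact: bounded_mfun_indic.
- by apply: QZ; [exact: bounded_mfun_indic|exact: Q_indic].
Qed.

End induction_on_bounded_mfun.

Section image_and_product.
Context d d' (T : measurableType d) (T' : measurableType d').

Lemma expect_distribution (P : probability T R) (X : {mfun T >-> T'}) (f : T' -> R) :
  bounded_mfun f -> expect (distribution P X) f = expect P (f \o X).
Proof.
move=> hf; rewrite /expect /Rintegral; congr fine.
rewrite integral_distribution//; first by apply/measurable_EFinP; case: hf.
exact/bounded_mfun_integrable/bounded_mfun_comp.
Qed.

Lemma eq_expect (P Q : probability T R) f : bounded_mfun f ->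
  (forall A, measurable A -> P A = Q A) -> expect P f = expect Q f.
Proof.
move=> hf PQ; rewrite /expect /Rintegral; congr fine.
by apply: eq_measure_integral => A mA _; exact: PQ.
Qed.

Lemma expect_prod (P : probability T R) (Q : probability T' R) (f : T * T' -> R) :
  bounded_mfun f ->
  expect (P \x Q)%E f = expect P (fun x => expect Q (fun y => f (x, y))).
Proof.
move=> hf; rewrite /expect /Rintegral; congr fine.
rewrite -integral12_prod_meas1 //; last exact: bounded_mfun_integrable.
apply: eq_integral => x _; rewrite /fubini_F -/(Rintegral Q setT (fun y => f (x, y))).
rewrite -/(expect Q (fun y => f (x, y))) expectE//.
have -> : (fun y => f (x, y)) = f \o (pair x) by [].
by apply: bounded_mfun_comp => //; exact: pair1_measurable.
Qed.

End image_and_product.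
End bounded_expectation.

(** * Laws on column vectors are determined by cosines *)

Section column_vectors.
Context {R : realType}.

Lemma measurable_cV_coord n (i : 'I_n) :
  measurable_fun setT (fun x : 'cV[R]_n => x i 0).
Proof.
move=> _ B mB; rewrite setTI; apply: sub_sigma_algebra.
rewrite -bigcup_seq/=; exists i => /=; first by rewrite mem_index_enum.
by exists B => //; rewrite setTI.
Qed.

Lemma measurable_fun_cV d (T : measurableType d) n (f : T -> 'cV[R]_n) :
  (forall i, measurable_fun setT (fun x => f x i 0)) -> measurable_fun setT f.
Proof.
move=> mf; apply: measurability => //.
move=> _ [A + <-]; rewrite -bigcup_seq => -[i _ [B mB <-]]; rewrite !setTI.
by have := mf i measurableT B mB; rewrite setTI.
Qed.

Lemma measurable_fun_linear m n d (T : measurableType d) (A : 'M[R]_(m, n))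
    (f : T -> 'cV[R]_n) :
  measurable_fun setT f -> measurable_fun setT (fun x => A *m f x).
Proof.
move=> mf; apply: measurable_fun_cV => i.
under eq_fun do rewrite mxE; apply: measurable_sum => k.
apply: measurable_funM; first exact: measurable_cst.
exact: (measurableT_comp (measurable_cV_coord k) mf).
Qed.

Lemma measurable_funD_cV n d (T : measurableType d) (f g : T -> 'cV[R]_n) :
  measurable_fun setT f -> measurable_fun setT g ->
  measurable_fun setT (fun x => f x + g x).
Proof.
move=> mf mg; apply: measurable_fun_cV => i.
under eq_fun do rewrite mxE; apply: measurable_funD.
  exact: (measurableT_comp (measurable_cV_coord i) mf).
exact: (measurableT_comp (measurable_cV_coord i) mg).
Qed.

Lemma measurable_form n d (T : measurableType d) (u : 'cV[R]_n)
    (f : T -> 'cV[R]_n) :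
  measurable_fun setT f -> measurable_fun setT (fun x => (u^T *m f x) 0 0).
Proof.
move=> /(measurable_fun_linear u^T) mf.
exact: (measurableT_comp (measurable_cV_coord 0) mf).
Qed.

End column_vectors.

Section trigonometric_closure.
Context {R : realType} {n : nat}.
Implicit Types f g : 'cV[R]_n -> R.

Definition lform (u x : 'cV[R]_n) : R := (u^T *m x) 0 0.

Lemma lformD u v x : lform (u + v) x = lform u x + lform v x.
Proof. by rewrite /lform linearD /= mulmxDl mxE. Qed.

Lemma lformN u x : lform (- u) x = - lform u x.
Proof. by rewrite /lform linearN /= mulNmx mxE. Qed.

(** The uniform bound in [trig_lim] is what lets dominated convergence carry an identity of
    expectations to the limit. *)
Inductive trig_closure : ('cV[R]_n -> R) -> Prop :=
| trig_cos u c : trig_closure (fun x => cos (lform u x + c))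
| trig_add f g : trig_closure f -> trig_closure g ->
    trig_closure (fun x => f x + g x)
| trig_scale (a : R) f : trig_closure f -> trig_closure (fun x => a * f x)
| trig_lim (F : nat -> 'cV[R]_n -> R) f (M : R) :
    (forall k, trig_closure (F k)) -> (forall k x, `|F k x| <= M) ->
    (forall x, F k x @[k --> \oo] --> f x) -> trig_closure f.

Lemma trig_closure_bounded f : trig_closure f -> bounded_mfun f.
Proof.
elim=> {f}.
- move=> u c; apply: (@bounded_mfun_cos _ _ _ (fun x => lform u x + c)).
  by apply: measurable_funD => //; apply: measurable_form; exact: measurable_id.
- by move=> f g _ hf _ hg; exact: bounded_mfunD.
- by move=> a f _ hf; exact: bounded_mfunZ.
- move=> F f M _ hF FM Ff; apply: (bounded_mfun_lim (F := F)) => // k.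
  by have [] := hF k.
Qed.

Lemma trig_closure_expect (P Q : probability 'cV[R]_n R) :
  (forall u c, expect P (fun x => cos (lform u x + c)) =
               expect Q (fun x => cos (lform u x + c))) ->
  forall f, trig_closure f -> expect P f = expect Q f.
Proof.
move=> PQ f; elim=> {f}.
- by move=> u c; exact: PQ.
- move=> f g /trig_closure_bounded hf fE /trig_closure_bounded hg gE.
  by rewrite !expectD// fE gE.
- by move=> a f /trig_closure_bounded hf fE; rewrite !expectZ// fE.
- move=> F f M hF FE FM Ff.
  have mF k : measurable_fun setT (F k).
    by have [] := trig_closure_bounded (hF k).
  have := expect_lim (P := P) mF FM Ff; under eq_fun do rewrite FE.
  by move=> /cvg_unique; apply => //; exact: expect_lim.
Qed.

Lemma trig_cst (a : R) : trig_closure (fun=> a).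
Proof.
have := trig_scale a (trig_cos 0 0).
congr trig_closure; apply/funext => x.
by rewrite /lform trmx0 mul0mx mxE addr0 cos0 mulr1.
Qed.

Lemma trig_sin u c : trig_closure (fun x => sin (lform u x + c)).
Proof.
have := trig_cos u (c - pi / 2).
congr trig_closure; apply/funext => x.
by rewrite addrA cosB cos_pihalf sin_pihalf mulr0 add0r mulr1.
Qed.

(** A double induction whose base case is the product-to-sum formula for two cosines; the bounds
    carried by the closure keep the products of limits bounded. *)
Lemma trig_mul f g : trig_closure f -> trig_closure g ->
  trig_closure (fun x => f x * g x).
Proof.
move=> hf; elim: hf g => {f}.
- move=> u c g; elim=> {g}.
  + move=> v c'.
    have h := trig_scale 2^-1
      (trig_add (trig_cos (u + v) (c + c')) (trig_cos (u + - v) (c - c'))).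
    move: h; congr trig_closure; apply/funext => x.
    rewrite !lformD lformN.
    rewrite (_ : _ + _ + (c + c') = (lform u x + c) + (lform v x + c')); last by ring.
    rewrite (_ : _ + _ + (c - c') = (lform u x + c) - (lform v x + c')); last by ring.
    by rewrite cosD cosB; field.
  + move=> f g _ hf _ hg; have := trig_add hf hg.
    by congr trig_closure; apply/funext => x; ring.
  + move=> a f _ hf; have := trig_scale a hf.
    by congr trig_closure; apply/funext => x; ring.
  + move=> F f M _ hF FM Ff; apply: (trig_lim (M := M) hF) => [k x|x].
      rewrite normrM (le_trans _ (FM k x))// ler_piMl//.
      by rewrite ler_norml cos_geN1 cos_le1.
    exact: cvgMl_tmp.
- move=> f1 f2 _ h1 _ h2 g hg; have := trig_add (h1 _ hg) (h2 _ hg).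
  by congr trig_closure; apply/funext => x; ring.
- move=> a f _ hf g hg; have := trig_scale a (hf _ hg).
  by congr trig_closure; apply/funext => x; ring.
- move=> F f M _ hF FM Ff g hg; have [_ [N gN]] := trig_closure_bounded hg.
  apply: (trig_lim (M := M * N) (fun k => hF k _ hg)) => [k x|x].
    by rewrite normrM ler_pM.
  exact: cvgMr_tmp.
Qed.

(* The cubic maps [-1, 1] to itself, fixes -1, 0 and 1, and its iterates
   converge to the sign. *)
Let p (y : R) : R := (3 * y - y ^+ 3) / 2.

Let p_bound y : `|y| <= 1 -> `|p y| <= 1.
Proof.
rewrite !ler_norml /p => /andP[y1 y2]; apply/andP; split.
  rewrite -subr_ge0 (_ : _ - _ = (1 + y) ^+ 2 * (2 - y) / 2); last by field.
  by rewrite divr_ge0// mulr_ge0 ?sqr_ge0//; lra.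
rewrite -subr_ge0 (_ : _ - _ = (1 - y) ^+ 2 * (2 + y) / 2); last by field.
by rewrite divr_ge0// mulr_ge0 ?sqr_ge0//; lra.
Qed.

Let p_iter_bound k y : `|y| <= 1 -> `|iter k p y| <= 1.
Proof. by move=> y1; elim: k => //= k; exact: p_bound. Qed.

Let p_iter_pos y : 0 < y -> y <= 1 -> iter k p y @[k --> \oo] --> (1 : R).
Proof.
(* One has 1 - p z = (1 - z) (1 - z (1 + z) / 2), and the iterates stay above y, so [r] bounds the
   contraction factor. *)
move=> y0 y1; pose r := 1 - y / 2.
have H k : [/\ y <= iter k p y, iter k p y <= 1 & 1 - iter k p y <= r ^+ k].
  elim: k => [|k [h1 h2 h3]] /=; first by rewrite expr0; split=> //; lra.
  set z := iter k p y in h1 h2 h3 *.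
  have z0 : 0 < z by exact: lt_le_trans h1.
  have e : 1 - p z = (1 - z) * (1 - z * (1 + z) / 2) by rewrite /p; field.
  have ez : p z - z = z * (1 - z) * (1 + z) / 2 by rewrite /p; field.
  split.
  - apply: (le_trans h1); rewrite -subr_ge0 ez divr_ge0// mulr_ge0//; last lra.
    by rewrite mulr_ge0//; lra.
  - have : `|p z| <= 1 by apply: p_bound; rewrite ger0_norm// ltW.
    by move=> /ler_normlP[].
  - rewrite e exprSr; apply: ler_pM => //; first lra.
      by rewrite subr_ge0 ler_pdivrMr// mul1r; nra.
    by rewrite /r lerD2l lerN2 ler_wpM2r//; nra.
have r1 : `|r| < 1 by rewrite ger0_norm /r; lra.
apply/cvgrPdist_le => e e0.
have /cvgrPdist_le/(_ e e0) := cvg_expr r1.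
apply: filterS => k; rewrite sub0r normrN => rk.
have [_ h2 h3] := H k; rewrite ger0_norm ?subr_ge0//.
exact: le_trans h3 (le_trans (ler_norm _) rk).
Qed.

Let pN y : p (- y) = - p y.
Proof. by rewrite /p; field. Qed.

Let p_iter_sg y : `|y| <= 1 -> iter k p y @[k --> \oo] --> Num.sg y.
Proof.
rewrite ler_norml => /andP[y1 y2]; have [y0|y0|->] := ltgtP y 0.
- rewrite ltr0_sg//.
  have E k : iter k p (- y) = - iter k p y by elim: k => //= k ->; rewrite pN.
  rewrite (_ : (fun k => iter k p y) = fun k => - iter k p (- y)).
    by apply: cvgN; apply: p_iter_pos; rewrite ?oppr_gt0// lerNl.
  by apply/funext => k; rewrite E opprK.
- by rewrite gtr0_sg//; exact: p_iter_pos.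
- rewrite sgr0 (_ : (fun k => _) = cst 0); first exact: cvg_cst.
  apply/funext; elim=> //= k ->; by rewrite /p expr0n mulr0 subr0 mul0r.
Qed.

(** With s the sign of f, a limit of iterates of the cubic at f, the indicator equals (s^2 + s) /
    2. *)
Lemma trig_gt0 f : (forall x, `|f x| <= 1) -> trig_closure f ->
  trig_closure \1_[set x | 0 < f x].
Proof.
move=> f1 hf.
have hp k : trig_closure (fun x => iter k p (f x)).
  elim: k => //= k IH.
  have := trig_scale 2^-1 (trig_add (trig_scale 3 IH)
    (trig_scale (-1) (trig_mul IH (trig_mul IH IH)))).
  by congr trig_closure; apply/funext => x; rewrite /p; field.
have hs : trig_closure (fun x => Num.sg (f x)).
  apply: (trig_lim (M := 1) hp) => [k x|x]; first exact: p_iter_bound.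
  exact: p_iter_sg.
have := trig_scale 2^-1 (trig_add (trig_mul hs hs) hs).
congr trig_closure; apply/funext => x; rewrite indicE.
have [fx|fx|fx] := ltgtP (f x) 0.
- rewrite memNset/= ?ltr0_sg//; last by apply/negP; rewrite -leNgt ltW.
  by field.
- by rewrite mem_set/= ?gtr0_sg//; field.
- rewrite memNset/= fx ?ltxx// sgr0; by field.
Qed.

(** The sine of (x_i - a) / (k + 1) has the sign of x_i - a as soon as k + 1 exceeds |x_i - a|, so
    the indicators of its positivity are eventually constant at each x. *)
Lemma trig_halfspace i (a : R) : trig_closure \1_[set x : 'cV[R]_n | a < x i 0].
Proof.
pose u : 'cV[R]_n := delta_mx i 0.
have uE (x : 'cV[R]_n) : lform u x = x i 0 by rewrite /lform trmx_delta -rowE mxE.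
pose f k (x : 'cV[R]_n) := sin ((x i 0 - a) / k.+1%:R).
have hf k : trig_closure \1_[set x | 0 < f k x].
  apply: trig_gt0 => [x|]; first by rewrite ler_norml sin_geN1 sin_le1.
  have := trig_sin (k.+1%:R^-1 *: u) (- a / k.+1%:R).
  congr trig_closure; apply/funext => x; congr sin.
  by rewrite /lform linearZ /= -scalemxAl mxE -/(lform u x) uE; ring.
apply: (trig_lim (M := 1) hf) => [k x|x].
  by rewrite indicE ger0_norm// lern1; case: (_ \in _).
apply: cvg_near_cst; near=> k; rewrite !indicE; congr (nat_of_bool _)%:R.
have kx : `|x i 0 - a| < k.+1%:R.
  rewrite (@lt_trans _ _ k%:R)// ?ltr_nat//.
  by near: k; exact: nbhs_infty_gtr.
have [xa|xa] := ltP a (x i 0).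
  rewrite !mem_set//=; apply: sin_gt0_pi; rewrite divr_gt0 ?subr_gt0//=.
  rewrite ltr_pdivrMr// (lt_trans (le_lt_trans (ler_norm _) kx))//.
  by rewrite ltr_pMl// (lt_le_trans _ (pi_ge2 _))// ltr1n.
rewrite !memNset//=; first by apply/negP; rewrite -leNgt.
apply/negP; rewrite -leNgt /f -(opprK (_ / _)) sinN oppr_le0 -mulNr opprB.
have xk : a - x i 0 < k.+1%:R.
  by rewrite (le_lt_trans _ kx)// -(opprB (x i 0)) ler_normr lexx orbT.
apply: sin_ge0_pi; rewrite divr_ge0 ?subr_ge0//= ler_pdivrMr// ltW//.
rewrite (lt_trans xk)//; by rewrite ltr_pMl// (lt_le_trans _ (pi_ge2 _))// ltr1n.
Unshelve. all: by end_near. Qed.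

Let trig_set (A : set 'cV[R]_n) := trig_closure \1_A.

Let trig_setC A : trig_set A -> trig_set (~` A).
Proof.
move=> hA; have := trig_add (trig_cst 1) (trig_scale (-1) hA).
congr trig_closure; apply/funext => x; rewrite !indicE in_setC.
by case: (x \in A); rewrite /= ?mulr0 ?mulr1 ?addr0 ?subrr.
Qed.

Let trig_setI A B : trig_set A -> trig_set B -> trig_set (A `&` B).
Proof.
move=> hA hB; have := trig_mul hA hB.
by congr trig_closure; apply/funext => x; rewrite indicI.
Qed.

Let trig_bigcap (F : nat -> set 'cV[R]_n) : (forall k, trig_set (F k)) ->
  trig_set (\bigcap_k F k).
Proof.
move=> hF; pose G k := \bigcap_(j < k) F j.
have hG k : trig_set (G k).
  elim: k => [|k IH].
    rewrite /trig_set /G bigcap_mkord big_ord0; have := trig_cst 1.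
    by congr trig_closure; apply/funext => x; rewrite indicE in_setT.
  rewrite /G bigcap_mkord big_ord_recr /= -bigcap_mkord.
  exact: trig_setI.
apply: (trig_lim (M := 1) hG) => [k x|x].
  by rewrite indicE ger0_norm// lern1; case: (_ \in _).
apply: cvg_near_cst.
have [xF|/existsNP[k /not_implyP[_ xk]]] := pselect (forall k, True -> F k x).
  apply: nearW => k; rewrite !indicE !mem_set//; move=> j _; exact: xF.
exists k.+1 => // m /= km; rewrite !indicE !memNset//.
  by move=> /(_ k I).
by move=> h; apply: xk; exact: h k km.
Qed.

Let trig_bigcup (F : nat -> set 'cV[R]_n) : (forall k, trig_set (F k)) ->
  trig_set (\bigcup_k F k).
Proof.
move=> hF; rewrite -(setCK (\bigcup_k F k)); apply: trig_setC.
by rewrite setC_bigcup; apply: trig_bigcap => k; exact: trig_setC.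
Qed.

(** Stability under products makes the sets with indicator in the closure a sigma-algebra outright,
    so no pi-lambda argument intervenes: it contains the half-spaces, hence all coordinate
    preimages. *)
Lemma trig_indic A : measurable A -> trig_closure \1_A.
Proof.
have trig0 : trig_set set0.
  rewrite -(setCK set0) setC0; apply: trig_setC; have := trig_cst 1.
  by congr trig_closure; apply/funext => x; rewrite indicE in_setT.
suff H : g_sigma_preimage (fun (i : 'I_n) (x : 'cV[R]_n) => x i 0) `<=` trig_set.
  exact: H.
apply: smallest_sub.
  split=> [|B hB|F hF]; [exact: trig0| |exact: trig_bigcup].
  by rewrite setTD; exact: trig_setC.
move=> {}A; rewrite -bigcup_seq => -[i _ [B mB <-]]; rewrite setTI; move: B mB => B.
move=> mB; have {}mB : (@RGenOInfty.G R).-sigma.-measurable B.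
  by rewrite -RGenOInfty.measurableE; exact: mB.
suff H : <<s @RGenOInfty.G R >> `<=`
    [set B | trig_set ((fun x : 'cV[R]_n => x i 0) @^-1` B)].
  exact: H.
apply: smallest_sub.
  split=> [|B1 hB|F hF] /=.
  - by rewrite preimage_set0.
  - by rewrite setTD preimage_setC; exact: trig_setC.
  - by rewrite preimage_bigcup; exact: trig_bigcup.
move=> _ [a ->] /=; have := trig_halfspace i a; congr trig_set.
by apply/seteqP; split=> x /=; rewrite in_itv/= andbT.
Qed.

Theorem eq_probability_cos (P Q : probability 'cV[R]_n R) :
  (forall u c, expect P (fun x => cos (lform u x + c)) =
               expect Q (fun x => cos (lform u x + c))) ->
  forall A, measurable A -> P A = Q A.
Proof.
move=> PQ A mA; have := trig_closure_expect PQ (trig_indic mA).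
rewrite !expect_indic// => e.
by rewrite -[P A]fineK ?fin_num_measure// -[Q A]fineK ?fin_num_measure// e.
Qed.

End trigonometric_closure.

(** * Brownian increments *)

Section laws.
Context {R : realType} d (T : measurableType d) (P : probability T R).

Section law.
Context d' (T' : measurableType d') (X : T -> T') (mX : measurable_fun setT X).

Definition mfun_of : {mfun T >-> T'} :=
  HB.pack X (isMeasurableFun.Build _ _ _ _ X mX).

Definition law : probability T' R := distribution P mfun_of.

Lemma lawE A : law A = P (X @^-1` A). Proof. by []. Qed.

Lemma expect_law (f : T' -> R) :
  bounded_mfun f -> expect law f = expect P (f \o X).
Proof. exact: expect_distribution. Qed.

End law.

Lemma eq_law_expect d' (T' : measurableType d') (X Y : T -> T') (f : T' -> R) :
  measurable_fun setT X -> measurable_fun setT Y -> bounded_mfun f ->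
  (forall A, measurable A -> P (X @^-1` A) = P (Y @^-1` A)) ->
  expect P (f \o X) = expect P (f \o Y).
Proof.
move=> mX mY hf XY; rewrite -(expect_law mX)// -(expect_law mY)//.
by apply: eq_expect => // A mA; exact: XY.
Qed.

(** The number [e] stands for the expectation of [g]; leaving it free lets [cos_cyl] insert the
    closed form supplied by its induction hypothesis. *)
Lemma expect_indep d' (T' : measurableType d') (Z : T -> T') (g : T -> R) (e : R) :
  measurable_fun setT Z -> bounded_mfun g ->
  (forall D, measurable D ->
    expect P (fun w => g w * \1_D (Z w)) = e * fine (P (Z @^-1` D))) ->
  forall f : T' -> R, bounded_mfun f ->
    expect P (fun w => g w * f (Z w)) = e * expect P (fun w => f (Z w)).
Proof.
move=> mZ hg gD; have hgf f : bounded_mfun f -> bounded_mfun (fun w => g w * f (Z w)).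
  by move=> hf; apply: bounded_mfunM => //; exact: (bounded_mfun_comp mZ hf).
have hfZ (f : T' -> R) : bounded_mfun f -> bounded_mfun (fun w => f (Z w)).
  by move=> hf; exact: (bounded_mfun_comp mZ hf).
apply: bounded_mfun_ind.
- move=> A mA; rewrite gD//; congr (_ * _).
  rewrite -expect_indic; last by rewrite -[_ @^-1` _]setTI; exact: mZ.
  by congr expect; apply/funext => w; rewrite !indicE.
- move=> f1 f2 h1 h2 e1 e2; rewrite expectD; [|exact: hfZ..].
  rewrite mulrDr -e1 -e2 -expectD; [|exact: hgf..].
  by congr expect; apply/funext => w; rewrite mulrDr.
- move=> c f hf ef; rewrite expectZ; last exact: hfZ.
  rewrite mulrCA -ef -expectZ; last exact: hgf.
  by congr expect; apply/funext => w; rewrite mulrCA.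
- move=> F f M hF FM Ff eF; have [_ [N gN]] := hg.
  have h1 : expect P (fun w => g w * F k (Z w)) @[k --> \oo] -->
      expect P (fun w => g w * f (Z w)).
    apply: (@expect_lim _ _ _ P (fun k w => g w * F k (Z w)) _ (N * M)).
    + by move=> k; have [] := hgf _ (hF k).
    + by move=> k w; rewrite normrM ler_pM.
    + by move=> w; apply: cvgMl_tmp; exact: Ff.
  have h2 : e * expect P (fun w => F k (Z w)) @[k --> \oo] -->
      e * expect P (fun w => f (Z w)).
    apply: cvgMl_tmp; apply: (@expect_lim _ _ _ P (fun k w => F k (Z w)) _ M) => //.
    by move=> k; have [] := hfZ _ (hF k).
  by move: h1; under eq_fun do rewrite eF; move=> /cvg_unique; apply.
Qed.

End laws.

Section brownian_increments.
Context {R : realType} d (Omega : measurableType d) (Pr : probability Omega R).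
Context n (W : R -> Omega -> 'cV[R]_n) (hW : brownian_motion Pr W) (i0 : 'I_n).

Let Z s t w := W t w - W s w.

Lemma measurable_increment s t : 0 <= s -> 0 <= t -> measurable_fun setT (Z s t).
Proof.
move=> s0 t0; rewrite (_ : Z s t = fun w => W t w + (- 1%:M) *m W s w).
  apply: measurable_funD_cV; first exact: (brownian_measurable hW).
  by apply: measurable_fun_linear; exact: (brownian_measurable hW).
by apply/funext => w; rewrite mulNmx mul1mx.
Qed.

Let m01 : measurable_fun setT (Z 0 1).
Proof. exact: measurable_increment. Qed.

Let mform u s t : 0 <= s -> 0 <= t -> measurable_fun setT (fun w => lform u (Z s t w)).
Proof. by move=> s0 t0; apply: measurable_form; exact: measurable_increment. Qed.

Let e0 : 'cV[R]_n := delta_mx i0 0.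

Let lform_e0 (x : 'cV[R]_n) : lform e0 x = x i0 0.
Proof. by rewrite /lform trmx_delta -rowE mxE. Qed.

Lemma lformZl (a : R) (u x : 'cV[R]_n) : lform (a *: u) x = a * lform u x.
Proof. by rewrite /lform linearZ /= -scalemxAl mxE. Qed.

Lemma lformZr (a : R) (u x : 'cV[R]_n) : lform u (a *: x) = a * lform u x.
Proof. by rewrite /lform -scalemxAr mxE. Qed.

Lemma lform_ge0 m (u : 'cV[R]_m) : 0 <= lform u u.
Proof. by rewrite /lform mxE sumr_ge0// => i _; rewrite mxE -expr2 sqr_ge0. Qed.

Lemma increment_normal u s t A : 0 <= s -> s <= t -> measurable A ->
  Pr ((fun w => lform u (Z s t w)) @^-1` A) = normal_law 0 ((t - s) * lform u u) A.
Proof.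
move=> s0 st mA; have := @brownian_gaussian _ _ _ _ _ _ hW s t _ u A mA.
rewrite s0 st => /(_ isT); rewrite mulmx0 mxE mul_mx_scalar -scalemxAl mxE.
exact.
Qed.

(* The characteristic function of N(0, v) at 1; only its multiplicativity and
   continuity in v are ever used, never its exponential form. *)
Definition phi (v : R) : R :=
  expect Pr (fun w => cos (Num.sqrt v * (W 1 w - W 0 w) i0 0)).

Let bounded_cos (X : Omega -> R) c : measurable_fun setT X ->
  bounded_mfun (fun w => cos (X w + c)).
Proof.
by move=> mX; apply: (bounded_mfun_cos (f := fun w => X w + c)); exact: measurable_funD.
Qed.

(** Both arguments of the cosine are centred normal with the same variance, so equality of laws
    replaces any Gaussian integral. *)
Let increment_cos0 u s t : 0 <= s -> s <= t ->
  expect Pr (fun w => cos (lform u (Z s t w))) = phi ((t - s) * lform u u).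
Proof.
move=> s0 st; have t0 := le_trans s0 st.
have v0 : 0 <= (t - s) * lform u u by rewrite mulr_ge0 ?subr_ge0// lform_ge0.
have hc := @bounded_mfun_cosR R.
transitivity (expect Pr
    (cos \o (fun w => lform (Num.sqrt ((t - s) * lform u u) *: e0) (Z 0 1 w)))).
  apply: (eq_law_expect (mform u s0 t0)) => //; first exact: mform.
  move=> A mA; rewrite (increment_normal u s0 st mA).
  rewrite (increment_normal _ (lexx 0) ler01 mA) lformZl lformZr.
  have e00 : lform e0 e0 = 1 by rewrite lform_e0 mxE !eqxx.
  congr (normal_law _ _ A).
  by rewrite e00 mulr1 subr0 mul1r -expr2 sqr_sqrtr.
by congr expect; apply/funext => w; rewrite /= lformZl lform_e0.
Qed.

(** The law is symmetric, as replacing u by - u does not change the variance, and sine is odd. *)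
Let increment_sin0 u s t : 0 <= s -> s <= t ->
  expect Pr (fun w => sin (lform u (Z s t w))) = 0.
Proof.
move=> s0 st; have t0 := le_trans s0 st.
have : expect Pr (sin \o (fun w => lform u (Z s t w))) =
       expect Pr (sin \o (fun w => lform (- u) (Z s t w))).
  apply: (eq_law_expect (mform u s0 t0) (mform (- u) s0 t0) (@bounded_mfun_sinR R)).
  move=> A mA; rewrite (increment_normal u s0 st mA).
  rewrite (increment_normal (- u) s0 st mA).
  congr (normal_law _ _ A); congr (_ * _).
  by rewrite lformN -[in lform u (- u)]scaleN1r lformZr mulN1r opprK.
have -> : sin \o (fun w => lform (- u) (Z s t w)) =
    fun w => -1 * sin (lform u (Z s t w)).
  by apply/funext => w /=; rewrite lformN sinN mulN1r.
rewrite expectZ; last by apply: bounded_mfun_sin; exact: mform.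
rewrite mulN1r => /eqP; rewrite -subr_eq0 opprK -mulr2n mulrn_eq0 /= => /eqP.
exact.
Qed.

Let t_seq (t : nat -> R) := 0 <= t 0%N /\ (forall i, t i <= t i.+1).

Let t_ge0 t i : t_seq t -> 0 <= t i.
Proof. by case=> t0 ti; elim: i => // i /le_trans; apply. Qed.

Section independence.
Variables (t : nat -> R) (b : nat -> 'cV[R]_n).
Hypothesis ht : t_seq t.

Let Zi i := Z (t i) (t i.+1).
Let X i w := lform (b i) (Zi i w).
Let v i := (t i.+1 - t i) * lform (b i) (b i).
Let S j w := \sum_(i < j) X i w.
Let cyl m (A : nat -> set 'cV[R]_n) := \bigcap_(i < m) (Zi i @^-1` A i).

Let mZi i : measurable_fun setT (Zi i).
Proof. by apply: measurable_increment; exact: t_ge0. Qed.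

Let mX i : measurable_fun setT (X i).
Proof. exact/measurable_form/mZi. Qed.

Let mS j : measurable_fun setT (S j).
Proof. by apply: measurable_sum => i; exact: mX. Qed.

Let mpre i A : measurable A -> measurable (Zi i @^-1` A).
Proof. by move=> mA; rewrite -[_ @^-1` _]setTI; exact: mZi. Qed.

Let mcyl m A : (forall i, measurable (A i)) -> measurable (cyl m A).
Proof.
move=> mA; rewrite /cyl bigcap_mkord.
by apply: bigsetI_measurable => i _; exact: mpre.
Qed.

Let Pr_cyl m A : (forall i, measurable (A i)) ->
  Pr (cyl m A) = (\prod_(i < m) Pr (Zi i @^-1` A i))%E.
Proof. by move=> mA; case: ht => t0 ti; exact: (brownian_independent hW m t0 ti mA). Qed.

(** Independence is given only for cylinders, so the induction over [j] carries a cylinder indicator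
    that is still unconstrained in the increments already summed. Each step adds one increment by
    the addition formula for the cosine. *)
Let cos_cyl m j : (j <= m)%N -> forall A c, (forall i, measurable (A i)) ->
  (forall i, (i < j)%N -> A i = setT) ->
  expect Pr (fun w => cos (S j w + c) * \1_(cyl m A) w) =
  \prod_(i < j) phi (v i) * cos c * fine (Pr (cyl m A)).
Proof.
elim: j => [_|j IH jm] A c mA AT.
  rewrite big_ord0 mul1r -expect_indic; last exact: mcyl.
  rewrite -expectZ; last exact/bounded_mfun_indic/mcyl.
  by congr expect; apply/funext => w; rewrite /S big_ord0 add0r.
have hb c' : bounded_mfun (fun w => cos (S j w + c') * \1_(cyl m A) w).
  by apply: bounded_mfunM; [exact: bounded_cos|exact/bounded_mfun_indic/mcyl].
have H c' f : bounded_mfun f ->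
    expect Pr (fun w => cos (S j w + c') * \1_(cyl m A) w * f (Zi j w)) =
    \prod_(i < j) phi (v i) * cos c' * fine (Pr (cyl m A)) *
      expect Pr (fun w => f (Zi j w)).
  apply: (expect_indep (mZi j) (hb c')) => D mD.
  (* Position [j] of the cylinder is free by assumption, so the event on the new increment can be
     stored there and the induction hypothesis applied to the enlarged cylinder. *)
  pose A' i := if i == j then D else A i.
  have mA' i : measurable (A' i) by rewrite /A'; case: ifP.
  have cylE : cyl m A' = cyl m A `&` Zi j @^-1` D.
    apply/seteqP; split => w /=.
      move=> h; split; last by have := h j jm; rewrite /A' /= eqxx.
      move=> i im; have := h i im; rewrite /A' /=; case: eqP => // -> _.
      by rewrite AT.
    by move=> [h hD] i im; rewrite /A' /=; case: eqP => [->//|_]; exact: h.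
  have PrE : Pr (cyl m A') = (Pr (Zi j @^-1` D) * Pr (cyl m A))%E.
    rewrite !Pr_cyl// (bigD1 (Ordinal jm))//= [in RHS](bigD1 (Ordinal jm))//=.
    rewrite AT// preimage_setT probability_setT mul1e {1}/A' eqxx.
    congr (_ * _)%E; apply: eq_bigr => i ij; rewrite /A'; case: eqP => // e.
    by case/eqP : ij; exact: val_inj.
  transitivity (expect Pr (fun w => cos (S j w + c') * \1_(cyl m A') w)).
    congr expect; apply/funext => w; rewrite cylE indicI /= -mulrA.
    by congr (_ * (_ * _)); rewrite !indicE.
  rewrite IH//; [|exact: ltnW|]; last first.
    by move=> i ij; rewrite /A' ltn_eqF// AT// ltnS ltnW.
  rewrite PrE fineM ?fin_num_measure//; [|exact: mpre|exact: mcyl].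
  by rewrite [fine (Pr (Zi j @^-1` D)) * _]mulrC mulrA.
have hcos : bounded_mfun (fun z => cos (lform (b j) z)).
  by apply: bounded_mfun_cos; apply: measurable_form; exact: measurable_id.
have hsin : bounded_mfun (fun z => sin (lform (b j) z)).
  by apply: bounded_mfun_sin; apply: measurable_form; exact: measurable_id.
have tj : t j <= t j.+1 by case: ht.
have tj0 : 0 <= t j by exact: t_ge0.
(* The sine of the partial sum is written as a cosine with phase c - pi / 2, so that the induction
   hypothesis covers it; its partner, the sine of the new increment, has mean 0. *)
transitivity (expect Pr (fun w =>
    cos (S j w + c) * \1_(cyl m A) w * cos (lform (b j) (Zi j w)) +
    -1 * (cos (S j w + (c - pi / 2)) * \1_(cyl m A) w * sin (lform (b j) (Zi j w))))).
  congr expect; apply/funext => w.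
  rewrite [S j w + (c - _)]addrA cosB cos_pihalf sin_pihalf mulr0 add0r mulr1.
  rewrite {1}/S big_ord_recr /= -/(S j w) addrAC cosD /X; ring.
have hbf c' f : bounded_mfun f ->
    bounded_mfun (fun w => cos (S j w + c') * \1_(cyl m A) w * f (Zi j w)).
  move=> hf; apply: bounded_mfunM (hb c') _.
  exact: (bounded_mfun_comp (mZi j) hf).
rewrite expectD; [|exact: (hbf c _ hcos)|exact/bounded_mfunZ/(hbf _ _ hsin)].
rewrite expectZ; last exact: (hbf _ _ hsin).
rewrite (H _ _ hcos) (H _ _ hsin) (increment_cos0 _ tj0 tj).
rewrite (increment_sin0 _ tj0 tj) !mulr0 addr0.
by rewrite big_ord_recr /= -/(v j); ring.
Qed.

Lemma increments_cos_prod m c :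
  expect Pr (fun w => cos (\sum_(i < m) lform (b i) (W (t i.+1) w - W (t i) w) + c)) =
  \prod_(i < m) phi (v i) * cos c.
Proof.
have mT : forall i : nat, measurable ((fun _ : nat => [set: 'cV[R]_n]) i) by [].
have := @cos_cyl m m (leqnn m) (fun=> setT) c mT (fun _ _ => erefl).
have -> : cyl m (fun=> setT) = setT.
  by apply/seteqP; split => // w _ i _.
rewrite probability_setT mulr1 => <-.
by congr expect; apply/funext => w; rewrite indicE in_setT mulr1.
Qed.

End independence.

Lemma phi0 : phi 0 = 1.
Proof.
rewrite /phi sqrtr0; under [X in expect _ X]eq_fun do rewrite mul0r cos0.
exact: expect_cst.
Qed.

(** The variances x and y are realised by one coordinate over adjacent time intervals of these
    lengths, whose union realises x + y. *)
Lemma phiD (x y : R) : 0 <= x -> 0 <= y -> phi (x + y) = phi x * phi y.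
Proof.
move=> x0 y0; pose t (i : nat) : R :=
  if i is 0%N then 0 else if i is 1%N then x else x + y.
have ht : t_seq t.
  split=> //= -[|[|i]] //=; first by rewrite lerDl.
have := @increments_cos_prod t (fun=> e0) ht 2 0.
rewrite !big_ord_recr !big_ord0 /= cos0 mulr1 mul1r.
rewrite [lform e0 e0]lform_e0 mxE !eqxx mulr1 subr0 mulr1 [x + y - x]addrC addKr => <-.
rewrite -[in LHS](subr0 (x + y)) -[X in phi X]mulr1.
have -> : 1 = lform e0 e0 :> R by rewrite lform_e0 mxE !eqxx.
rewrite -increment_cos0 ?addr_ge0//; congr expect; apply/funext => w.
rewrite !big_ord_recr big_ord0 /= addr0 add0r /Z !lform_e0 !mxE.
by congr cos; ring.
Qed.

Lemma phi_sum m (x : nat -> R) : (forall i, 0 <= x i) ->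
  phi (\sum_(i < m) x i) = \prod_(i < m) phi (x i).
Proof.
move=> x0; elim: m => [|m IH]; first by rewrite !big_ord0 phi0.
by rewrite !big_ord_recr /= phiD ?IH// sumr_ge0.
Qed.

Lemma increments_cos (t : nat -> R) (b : nat -> 'cV[R]_n) m c :
  0 <= t 0%N -> (forall i, t i <= t i.+1) ->
  expect Pr (fun w => cos (\sum_(i < m) lform (b i) (W (t i.+1) w - W (t i) w) + c)) =
  phi (\sum_(i < m) (t i.+1 - t i) * lform (b i) (b i)) * cos c.
Proof.
move=> t0 ti; rewrite increments_cos_prod//.
rewrite -(phi_sum _ (x := fun i => (t i.+1 - t i) * lform (b i) (b i)))//.
by move=> i; rewrite mulr_ge0 ?subr_ge0// lform_ge0.
Qed.

Lemma cvg_phi (x : nat -> R) (y : R) : x k @[k --> \oo] --> y ->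
  phi (x k) @[k --> \oo] --> phi y.
Proof.
move=> xy; apply: (@expect_lim _ _ _ Pr
    (fun k w => cos (Num.sqrt (x k) * (W 1 w - W 0 w) i0 0)) _ 1).
- move=> k; apply: (measurableT_comp (proj1 (@bounded_mfun_cosR R))).
  apply: measurable_funM => //.
  exact: (measurableT_comp (measurable_cV_coord i0) m01).
- by move=> k w; rewrite ler_norml cos_geN1 cos_le1.
- move=> w; apply: continuous_cvg; first exact: continuous_cos.
  by apply: cvgMr_tmp; apply: continuous_cvg => //; exact: sqrt_continuous.
Qed.

End brownian_increments.

(** * Riemann-Stieltjes sums *)

Section riemann_stieltjes.
Context {R : realType}.

Lemma deriv0_cst (f : R -> R) (t : R) :
  (forall s : R, 0 <= s -> is_derive s (1 : R) f 0) -> 0 <= t -> f t = f 0.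
Proof.
move=> f0 t0; have [|| c _ /eqP] := @MVT_segment R f (fun=> 0) 0 t t0.
- by move=> x; rewrite in_itv/= => /andP[/ltW x0 _]; exact: f0.
- apply: derivable_within_continuous => x; rewrite in_itv/= => /andP[x0 _].
  by have [] := f0 x x0.
- by rewrite mul0r subr_eq0 => /eqP.
Qed.

Lemma segment_uniform_continuity (f : R -> R) (t e : R) :
  (forall x, 0 <= x <= t -> {for x, continuous f}) -> 0 < e ->
  exists2 r : R, 0 < r &
    forall x y, 0 <= x <= t -> `|y - x| < r -> `|f y - f x| <= e.
Proof.
move=> cf e0.
have /compact_near_coveringP/(_ R (0 : R)^'+
  (fun r x => forall y, `|y - x| < r -> `|f y - f x| <= e) _) := @segment_compact R 0 t.
move=> H; have {}H : \forall r \near (0 : R)^'+, `[0, t]%classic `<=`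
    [set x | forall y, `|y - x| < r -> `|f y - f x| <= e].
  apply: H => x; rewrite /= in_itv/= => xt.
  have e20 : 0 < e / 2 by rewrite divr_gt0.
  have /cvgrPdist_le/(_ _ e20)/nbhs_ballP[r /= r0 rf] := cf x xt.
  exists (ball x (r / 2), [set d | d < r / 2]).
    split=> /=; first by apply: nbhsx_ballx; rewrite divr_gt0.
    by apply: nbhs_right_lt; rewrite divr_gt0.
  move=> [x' d] /= [xx' dr] y yx'.
  have h1 : `|f x - f y| <= e / 2.
    apply: rf; rewrite /ball/=.
    rewrite (_ : x - y = (x - x') - (y - x')); last by ring.
    rewrite (le_lt_trans (ler_normB _ _))// [ltRHS](splitr r) ltrD//.
    exact: lt_trans yx' dr.
  have h2 : `|f x - f x'| <= e / 2.
    apply: rf; rewrite /ball/= (lt_trans xx')//.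
    by rewrite ltr_pdivrMr// ltr_pMr// ltr1n.
  rewrite (_ : f y - f x' = (f x - f x') - (f x - f y)); last by ring.
  by rewrite (le_trans (ler_normB _ _))// [leRHS](splitr e) lerD.
near (0 : R)^'+ => r; exists r => // x y xt; last first.
  by move: x xt y => x xt; move: (x) xt; near: r;
     apply: filterS H => r rf x' xt y; exact: rf.
Unshelve. all: by end_near. Qed.

Lemma segment_bounded (f : R -> R) (t : R) :
  (forall x, 0 <= x <= t -> {for x, continuous f}) ->
  exists2 K : R, 0 < K & forall x, 0 <= x <= t -> `|f x| <= K.
Proof.
move=> cf.
have /compact_near_coveringP/(_ R +oo%R
  (fun K x => `|f x| <= K) _) := @segment_compact R 0 t.
move=> H; have {}H : \forall K \near +oo%R, `[0, t]%classic `<=`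
    [set x | `|f x| <= K].
  apply: H => x; rewrite /= in_itv/= => xt.
  have /cvgrPdist_le/(_ 1 ltr01) := cf x xt => xf.
  exists ([set y | `|f x - f y| <= 1], [set K | `|f x| + 1 <= K]).
    split=> //=; apply: nbhs_pinfty_ge; exact: num_real.
  move=> [y K] /= [h1 h2]; apply: le_trans h2.
  rewrite -[f y](subrK (f x)) addrC (le_trans (ler_normD _ _))// lerD2l.
  by rewrite distrC.
near (+oo%R : set_system R) => K; exists K => // x xt.
by move: x xt; near: K; apply: filterS H => K KH x xt; apply: KH.
Unshelve. all: by end_near. Qed.

(** There are [m.+1] cells, so the mesh is always defined; the points continue past t because
    [increments_cos] takes an infinite sequence of times. *)
Definition grid (t : R) (m i : nat) : R := t * i%:R / m.+1%:R.

Lemma grid0 t m : grid t m 0 = 0.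
Proof. by rewrite /grid mulr0 mul0r. Qed.

Lemma grid_last t m : grid t m m.+1 = t.
Proof. by rewrite /grid mulfK. Qed.

Lemma grid_step t m i : grid t m i.+1 - grid t m i = t / m.+1%:R.
Proof. by rewrite /grid -mulrBl -mulrBr -natrB// subSnn mulr1. Qed.

Lemma grid_le t m i : 0 <= t -> grid t m i <= grid t m i.+1.
Proof. by move=> t0; rewrite -subr_ge0 grid_step divr_ge0. Qed.

Lemma grid_ge0 t m i : 0 <= t -> 0 <= grid t m i.
Proof. by move=> t0; rewrite /grid divr_ge0// mulr_ge0. Qed.

Lemma grid_le_last t m i : 0 <= t -> (i <= m.+1)%N -> grid t m i <= t.
Proof.
move=> t0 im; rewrite /grid ler_pdivrMr// ler_wpM2l// ler_nat//.
Qed.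

(** If a(x, y) matches F y - F x up to a uniform o(y - x), the errors add up to o(1) and the
    differences of F telescope. Tolerance e / (t + 1) instead of e / t covers t = 0. *)
Lemma grid_sum_cvg (a : R -> R -> R) (F : R -> R) (t : R) : 0 <= t ->
  (forall e, 0 < e -> exists2 r : R, 0 < r & forall x y,
    0 <= x -> x <= y -> y <= t -> y - x < r ->
    `|a x y - (F y - F x)| <= e * (y - x)) ->
  \sum_(i < m.+1) a (grid t m i) (grid t m i.+1) @[m --> \oo] --> F t - F 0.
Proof.
move=> t0 aF; apply/cvgrPdist_le => e e0.
have t1 : 0 < t + 1 by rewrite ltr_wpDl.
have [r r0 ra] := aF (e / (t + 1)) (divr_gt0 e0 t1).
near=> m.
have tm : t / m.+1%:R < r.
  rewrite ltr_pdivrMr// mulrC -ltr_pdivrMr//.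
  rewrite (@lt_trans _ _ m%:R)// ?ltr_nat//.
  by near: m; exact: nbhs_infty_gtr.
have -> : F t - F 0 = \sum_(i < m.+1) (F (grid t m i.+1) - F (grid t m i)).
  rewrite -(big_mkord xpredT (fun i => F (grid t m i.+1) - F (grid t m i))).
  by rewrite telescope_sumr// grid0 grid_last.
rewrite distrC -sumrB (le_trans (ler_norm_sum _ _ _))//.
apply: (@le_trans _ _ (\sum_(i < m.+1) e / (t + 1) * (grid t m i.+1 - grid t m i))).
  apply: ler_sum => i _; apply: ra.
  - exact: grid_ge0.
  - exact: grid_le.
  - by apply: grid_le_last.
  - by rewrite grid_step.
rewrite -mulr_sumr.
rewrite -(big_mkord xpredT (fun i => grid t m i.+1 - grid t m i)).
rewrite telescope_sumr// grid0 grid_last subr0 -mulrA ler_piMr ?(ltW e0)//.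
by rewrite mulrC ler_pdivrMr// mul1r lerDl.
Unshelve. all: by end_near. Qed.

Let MVT0 (f df : R -> R) (t x y : R) :
  (forall s, 0 <= s <= t -> is_derive s (1 : R) f (df s)) ->
  0 <= x -> x <= y -> y <= t ->
  exists2 c : R, x <= c <= y & f y - f x = df c * (y - x).
Proof.
move=> fd x0 xy yt.
have fd' z : x <= z -> z <= y -> is_derive z (1 : R) f (df z).
  by move=> xz zy; apply: fd; rewrite (le_trans x0 xz) (le_trans zy yt).
have [|| c + e] := @MVT_segment R f df x y xy.
- by move=> z; rewrite in_itv/= => /andP[/ltW xz /ltW zy]; exact: fd'.
- apply: derivable_within_continuous => z; rewrite in_itv/= => /andP[xz zy].
  by have [] := fd' z xz zy.
- by rewrite in_itv/= => xcy; exists c.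
Qed.

Lemma riemann_sum_cvg (q F : R -> R) (t : R) : 0 <= t ->
  (forall s, 0 <= s <= t -> is_derive s (1 : R) F (q s)) ->
  (forall s, 0 <= s <= t -> {for s, continuous q}) ->
  \sum_(i < m.+1) (grid t m i.+1 - grid t m i) * q (grid t m i) @[m --> \oo]
    --> F t - F 0.
Proof.
move=> t0 Fd cq; apply: (@grid_sum_cvg (fun x y => (y - x) * q x)) => // e e0.
have [r r0 rq] := segment_uniform_continuity cq e0.
exists r => // x y x0 xy yt yx.
have [c /andP[xc cy] ->] := MVT0 Fd x0 xy yt.
rewrite [q c * _]mulrC -mulrBr normrM ger0_norm ?subr_ge0// mulrC.
rewrite ler_wpM2r ?subr_ge0// distrC; apply: rq.
  by rewrite x0 (le_trans xy).
by rewrite ger0_norm ?subr_ge0// (le_lt_trans _ yx)// lerD2r.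
Qed.

Let abel_sum (b w : nat -> R) m :
  \sum_(i < m) b i * (w i.+1 - w i) =
  b m * w m - b 0%N * w 0%N - \sum_(i < m) (b i.+1 - b i) * w i.+1.
Proof.
elim: m => [|m IH]; first by rewrite !big_ord0 subrr subr0.
by rewrite !big_ord_recr /= IH; ring.
Qed.

(** The integrator [w] is merely continuous, so Abel summation moves the differences onto the smooth
    [b]. The mean value theorem for b w(y) - F, with y fixed, then compares (b y - b x) w y with F y
    - F x. *)
Lemma stieltjes_sum_cvg (b db w F : R -> R) (t : R) : 0 <= t -> w 0 = 0 ->
  (forall s, 0 <= s <= t -> is_derive s (1 : R) b (db s)) ->
  (forall s, 0 <= s <= t -> {for s, continuous db}) ->
  (forall s, 0 <= s <= t -> {for s, continuous w}) ->
  (forall s, 0 <= s <= t -> is_derive s (1 : R) F (db s * w s)) ->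
  \sum_(i < m.+1) b (grid t m i) * (w (grid t m i.+1) - w (grid t m i))
    @[m --> \oo] --> b t * w t - (F t - F 0).
Proof.
move=> t0 w0 bd cdb cw Fd.
under eq_fun do rewrite (abel_sum (fun i => b (grid t _ i)) (fun i => w (grid t _ i)))
  grid0 grid_last w0 mulr0 subr0.
apply: cvgB; first exact: cvg_cst.
apply: (@grid_sum_cvg (fun x y => (b y - b x) * w y)) => // e e0.
have [K K0 Kdb] := segment_bounded cdb.
have [r r0 rw] := segment_uniform_continuity cw (divr_gt0 e0 K0).
exists r => // x y x0 xy yt yx.
have gd s : 0 <= s <= t ->
    is_derive s (1 : R) (fun s => b s * w y - F s) (db s * (w y - w s)).
  move=> st; have h1 := is_deriveZ (w y) (bd s st).
  have h2 := is_deriveB h1 (Fd s st).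
  rewrite mulrBr [db s * w y]mulrC.
  rewrite (_ : (fun s => _) = (w y \*: b) - F); first exact: h2.
  by apply/funext => z /=; rewrite /GRing.scale /= mulrC.
have [c /andP[xc cy] e1] := MVT0 gd x0 xy yt.
have -> : (b y - b x) * w y - (F y - F x) = db c * (w y - w c) * (y - x).
  by rewrite -e1; ring.
have ct : 0 <= c <= t by rewrite (le_trans x0 xc) (le_trans cy yt).
rewrite normrM [`|y - x|]ger0_norm ?subr_ge0// ler_wpM2r ?subr_ge0//.
rewrite normrM [leRHS](_ : e = K * (e / K)); last by field; rewrite gt_eqF.
rewrite ler_pM//; first exact: Kdb.
apply: rw => //; rewrite ger0_norm ?subr_ge0// (le_lt_trans _ yx)//.
by rewrite lerD2l lerN2.
Qed.

(** Integrals start at -1 so that 0 is an interior point and the derivative there is two-sided. *)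
Definition prim (f : R -> R) (t : R) : R :=
  \int[lebesgue_measure]_(s in `[-1, t]) f s -
  \int[lebesgue_measure]_(s in `[-1, 0]) f s.

Lemma prim0 f : prim f 0 = 0.
Proof. by rewrite /prim subrr. Qed.

Let continuous_integrable (f : R -> R) (a b : R) : continuous f ->
  lebesgue_measure.-integrable `[a, b] (EFin \o f).
Proof.
move=> cf; apply: continuous_compact_integrable; first exact: segment_compact.
exact: continuous_subspaceT.
Qed.

Lemma prim_deriv (f : R -> R) (t : R) : continuous f -> 0 <= t ->
  is_derive t (1 : R) (prim f) (f t).
Proof.
move=> cf t0; have t1 : t < t + 1 by rewrite ltrDl.
have t2 : -1 < t by rewrite (lt_le_trans _ t0)// ltrN10.
have [h1 h2] := @continuous_FTC1_closed R f (-1) t (t + 1) t1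
  (continuous_integrable (-1) (t + 1) cf) t2 (cf t).
have h3 : is_derive t (1 : R)
    (fun x => \int[lebesgue_measure]_(s in `[-1, x]) f s) (f t).
  by rewrite -h2 derive1E; exact: (@DeriveDef _ _ _ _ _ _ _ h1 erefl).
rewrite -[f t]subr0.
exact: is_deriveB h3 (is_derive_cst (\int[lebesgue_measure]_(s in `[-1, 0]) f s) _ _).
Qed.

Lemma primE (f : R -> R) (t : R) : continuous f -> 0 <= t ->
  prim f t = \int[lebesgue_measure]_(s in `[0, t]) f s.
Proof.
move=> cf t0; rewrite /prim Rintegral_itvB; last 3 first.
- exact: continuous_integrable.
- by rewrite bnd_simp lerN10.
- by rewrite bnd_simp.
rewrite Rintegral_itv_obnd_cbnd//.
apply: integrableS (continuous_integrable 0 t cf) => //.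
by apply: subset_itvr; rewrite bnd_simp.
Qed.

(** Composition with the positive part extends a path from [0, +oo[ continuously to the whole
    line. *)
Definition pos (s : R) : R := (s + `|s|) / 2.

Lemma pos_ge0 s : 0 <= pos s.
Proof. by rewrite /pos divr_ge0// -lerBlDl sub0r -normrN ler_norm. Qed.

Lemma pos_id s : 0 <= s -> pos s = s.
Proof. by move=> s0; rewrite /pos ger0_norm//; field. Qed.

Lemma continuous_pos : continuous pos.
Proof.
move=> s; apply: cvgMr_tmp; apply: cvgD; first exact: cvg_id.
exact: norm_continuous.
Qed.

Lemma within_continuous_pos (U : topologicalType) (f : R -> U) :
  {within `[0, +oo[, continuous f} -> continuous (f \o pos).
Proof.
move=> cf s; have ps : `[0, +oo[%classic (pos s) by rewrite /= in_itv/= andbT pos_ge0.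
have := cf (pos s); rewrite /continuous_at /nbhs/= -(nbhs_subspace_in ps) => H V fV.
have := H V fV; rewrite /within/= => hV.
have h : \forall x \near s, pos x \in `[0, +oo[ -> V (f (pos x)).
  exact: (@continuous_pos s _ hV).
change (\forall x \near s, V (f (pos x))).
by apply: filterS h => x; apply; rewrite in_itv/= andbT pos_ge0.
Qed.

End riemann_stieltjes.

(** * Continuity and primitives of matrix-valued paths *)

Section matrix_paths.
Context {R : realType}.

Lemma cvg_mx (T : Type) (F : set_system T) {FF : Filter F} m n
    (f : T -> 'M[R]_(m, n)) (l : 'M[R]_(m, n)) :
  (forall i j, f x i j @[x --> F] --> l i j) -> f x @[x --> F] --> l.
Proof.
move=> H A [P /= Pn PA].
have : \forall x \near F, forall i j, P i j (f x i j).
  by apply: filter_forall => i; apply: filter_forall => j; apply: H; exact: Pn.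
by apply: filterS => x Hx; apply: PA => i j; exact: Hx.
Qed.

Definition mcontinuous m n (F : R -> 'M[R]_(m, n)) (t : R) :=
  forall i j, {for t, continuous (fun s => F s i j)}.

Lemma mderive_mcontinuous m n (F : R -> 'M[R]_(m, n)) dF t :
  mderive F dF t -> mcontinuous F t.
Proof.
move=> h i j; apply: differentiable_continuous; apply/derivable1_diffP.
by have [] := h i j.
Qed.

Lemma mcontinuous_cst m n (A : 'M[R]_(m, n)) t : mcontinuous (fun=> A) t.
Proof. by move=> i j; exact: cvg_cst. Qed.

Lemma mcontinuousD m n (F G : R -> 'M[R]_(m, n)) t :
  mcontinuous F t -> mcontinuous G t -> mcontinuous (fun s => F s + G s) t.
Proof.
move=> hF hG i j; rewrite /prop_for /continuous_at mxE; under eq_fun do rewrite mxE.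
by apply: cvgD; [exact: hF|exact: hG].
Qed.

Lemma mcontinuous_mul m n p (F : R -> 'M[R]_(m, n)) (G : R -> 'M[R]_(n, p)) t :
  mcontinuous F t -> mcontinuous G t -> mcontinuous (fun s => F s *m G s) t.
Proof.
move=> hF hG i j; rewrite /prop_for /continuous_at mxE; under eq_fun do rewrite mxE.
by apply: cvg_sumR => k; apply: cvgM; [exact: hF|exact: hG].
Qed.

Lemma mcontinuousZl m n p (A : 'M[R]_(m, n)) (G : R -> 'M[R]_(n, p)) t :
  mcontinuous G t -> mcontinuous (fun s => A *m G s) t.
Proof. exact/mcontinuous_mul/mcontinuous_cst. Qed.

Lemma mcontinuous_within m n (F : R -> 'M[R]_(m, n)) :
  (forall t, 0 <= t -> mcontinuous F t) -> {within `[0, +oo[, continuous F}.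
Proof.
move=> hF; apply: continuous_in_subspaceT => t; rewrite inE/= in_itv/= andbT => t0.
by apply: cvg_mx => i j; exact: hF.
Qed.

Lemma within_mcontinuous_pos m n (F : R -> 'M[R]_(m, n)) t :
  {within `[0, +oo[, continuous F} -> mcontinuous (fun s => F (pos s)) t.
Proof.
move=> /within_continuous_pos cF i j.
exact: (cvg_comp _ _ (cF t) (@coord_continuous _ _ _ i j _)).
Qed.

Definition mprim n (V : R -> 'cV[R]_n) (t : R) : 'cV[R]_n :=
  \col_i prim (fun s => V s i 0) t.

Lemma mprim0 n (V : R -> 'cV[R]_n) : mprim V 0 = 0.
Proof. by apply/matrixP => i j; rewrite !mxE prim0. Qed.

Lemma mderive_mprim n (V : R -> 'cV[R]_n) t : (forall s, mcontinuous V s) ->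
  0 <= t -> mderive (mprim V) (V t) t.
Proof.
move=> cV t0 i j; rewrite (ord1 j); under eq_fun do rewrite mxE.
by apply: prim_deriv => // s; exact: cV.
Qed.

Lemma mderive0_cst m n (F : R -> 'M[R]_(m, n)) t :
  (forall s, 0 <= s -> mderive F 0 s) -> 0 <= t -> F t = F 0.
Proof.
move=> F0 t0; apply/matrixP => i j; apply: (deriv0_cst (f := fun s => F s i j)) => //.
by move=> s s0; have := F0 s s0 i j; rewrite mxE.
Qed.

End matrix_paths.

(** * Linear equations with additive noise *)

Section linear_sde.
Context {R : realType} d (Omega : measurableType d) (Pr : probability Omega R).
Context p (W : R -> Omega -> 'cV[R]_p) (hW : brownian_motion Pr W).

Lemma ae_null_set (A : set Omega) : {ae Pr, forall w, A w} ->
  exists N, [/\ measurable N, Pr N = 0%E & forall w, ~ N w -> A w].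
Proof.
move=> [N [mN N0 NA]]; exists N; split=> // w Nw.
by apply: contrapT => nA; apply: Nw; apply: NA.
Qed.

Lemma null_set_ae (N A : set Omega) : measurable N -> Pr N = 0%E ->
  (forall w, ~ N w -> A w) -> {ae Pr, forall w, A w}.
Proof.
move=> mN N0 NA; exists N; split=> // w /= nA.
by apply: contrapT => Nw; apply: nA; exact: NA.
Qed.

Record regular_version (W' : R -> Omega -> 'cV[R]_p) : Prop := {
  regular_measurable : forall s, measurable_fun setT (W' s) ;
  regular_continuous : forall w s, mcontinuous (W' ^~ w) s ;
  regular_start : forall w, W' 0 w = 0 ;
  regular_ae : {ae Pr, forall w, forall s, 0 <= s -> W' s w = W s w}
}.

(** Paths are set to 0 on the null set where W fails to start at 0 or to be continuous, and frozen
    at time 0 for negative times. *)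
Lemma exists_regular_version : exists W', regular_version W'.
Proof.
have [N1 [mN1 N10 N1W]] := ae_null_set (brownian_start hW).
have [N2 [mN2 N20 N2W]] := ae_null_set (brownian_continuous hW).
pose N := N1 `|` N2.
have mN : measurable N by exact: measurableU.
have N0 : Pr N = 0%E by rewrite null_set_setU.
exists (fun s w => \1_(~` N) w *: W (pos s) w); split.
- move=> s; apply: measurable_fun_cV => i; under eq_fun do rewrite mxE.
  apply: measurable_funM; first by apply: measurable_indic; exact: measurableC.
  apply: (measurableT_comp (measurable_cV_coord i)).
  by apply: (brownian_measurable hW); exact: pos_ge0.
- move=> w s i j.
  rewrite (_ : (fun s => _) = fun s => \1_(~` N) w * W (pos s) w i j); last first.
    by apply/funext => s'; rewrite mxE.
  have [wN|wN] := pselect (N w).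
    rewrite indicE in_setC mem_set//= (_ : (fun _ => _) = cst 0).
      exact: cvg_cst.
    by apply/funext => s'; rewrite mul0r.
  apply: cvgMl_tmp; apply: (within_mcontinuous_pos (F := fun s => W s w)).
  by apply: N2W => h; apply: wN; right.
- move=> w; rewrite pos_id// indicE in_setC.
  have [wN|wN] := pselect (N w); first by rewrite mem_set//= scale0r.
  by rewrite N1W ?scaler0// => h; apply: wN; left.
- apply: (null_set_ae mN N0) => w wN s s0.
  by rewrite pos_id// indicE in_setC memNset//= scale1r.
Qed.

Section solution.
Variables (n : nat) (B : 'M[R]_n) (S : 'M[R]_(n, p)).
Variables (W' : R -> Omega -> 'cV[R]_p) (hW' : regular_version W').

Let E := expm B.

Let V w s : 'cV[R]_n := E (- s) *m (B *m (S *m W' s w)).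

Definition sde_noise (t : R) (w : Omega) : 'cV[R]_n :=
  E t *m mprim (V w) t + S *m W' t w.

Let V_cont w s : mcontinuous (V w) s.
Proof.
apply: mcontinuous_mul; first exact/mderive_mcontinuous/mderive_expmN.
by do 2 apply: mcontinuousZl; exact: (regular_continuous hW').
Qed.

(** The solution minus S W'. Unlike the solution it is differentiable, and it solves Z' = B (Z + S
    W'), so ordinary calculus applies. *)
Let Z x w t : 'cV[R]_n := E t *m (x + mprim (V w) t).

Let Z_sol x w t : E t *m x + sde_noise t w = Z x w t + S *m W' t w.
Proof. by rewrite /sde_noise /Z mulmxDr addrA. Qed.

Let Z_deriv x w t : 0 <= t ->
  mderive (Z x w) (B *m (Z x w t + S *m W' t w)) t.
Proof.
move=> t0.
have h := mderive_mul (mderive_expm B t)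
  (mderiveD (mderive_cst x t) (mderive_mprim (@V_cont w) t0)).
move: h; rewrite add0r expmC -mulmxA.
rewrite (_ : expm B t *m V w t = B *m (S *m W' t w)); last first.
  by rewrite /V mulmxA expmKN mul1mx.
by rewrite -mulmxDr.
Qed.

Let Z0 x w : Z x w 0 = x.
Proof. by rewrite /Z mprim0 addr0 /E expm0 mul1mx. Qed.

Lemma sde_noise_continuous x w t : 0 <= t ->
  mcontinuous (fun t => E t *m x + sde_noise t w) t.
Proof.
move=> t0; under eq_fun do rewrite Z_sol.
apply: mcontinuousD; first exact: mderive_mcontinuous (Z_deriv x w t0).
apply: mcontinuousZl; exact: (regular_continuous hW').
Qed.

(* The drift integral of a path that is continuous on [0, +oo[, extended to a
   differentiable function on the whole line. *)
Let drift_int (Y : R -> 'cV[R]_n) : R -> 'cV[R]_n := mprim (fun s => B *m Y (pos s)).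

Let drift_intE (Y : R -> 'cV[R]_n) t : {within `[0, +oo[, continuous Y} -> 0 <= t ->
  drift_int Y t = \col_i \int[lebesgue_measure]_(s in `[0, t]) (B *m Y s) i 0.
Proof.
move=> cY t0; apply/matrixP => i j; rewrite !mxE primE//; last first.
  by move=> s; exact: (mcontinuousZl (A := B) (within_mcontinuous_pos cY)).
apply: eq_Rintegral => s; rewrite inE/= in_itv/= => /andP[s0 _].
by rewrite pos_id.
Qed.

Let drift_int_deriv (Y : R -> 'cV[R]_n) t : {within `[0, +oo[, continuous Y} -> 0 <= t ->
  mderive (drift_int Y) (B *m Y t) t.
Proof.
move=> cY t0; rewrite -{1}(pos_id t0); apply: mderive_mprim => // s.
exact: (mcontinuousZl (A := B) (within_mcontinuous_pos cY)).
Qed.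

Let drift_int_noise x w t : 0 <= t ->
  Z x w t = x + drift_int (fun t => E t *m x + sde_noise t w) t.
Proof.
move=> t0; set Y := fun t => _.
have cY : {within `[0, +oo[, continuous Y}.
  by apply: mcontinuous_within => s s0; exact: sde_noise_continuous.
have : Z x w t + (-1 : R) *: drift_int Y t = Z x w 0 + (-1 : R) *: drift_int Y 0.
  apply: (mderive0_cst (F := fun t => Z x w t + (-1 : R) *: drift_int Y t)) => //.
  move=> s s0.
  have h1 := Z_deriv x w s0; have h2 := drift_int_deriv cY s0.
  have h3 := mderive_mul (mderive_cst (- 1%:M : 'M[R]_n) s) h2.
  have := mderiveD h1 h3; rewrite mul0mx add0r mulNmx mul1mx /Y Z_sol subrr.
  by under eq_fun do rewrite mulNmx mul1mx -scaleN1r.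
rewrite Z0 /drift_int mprim0 scaler0 addr0 scaleN1r => e.
by rewrite -[X in _ = X + _]e subrK.
Qed.

Lemma measurable_limit (D : nat -> Omega -> R) (f : Omega -> R) :
  (forall m, measurable_fun setT (D m)) ->
  (forall w, D m w @[m --> \oo] --> f w) -> measurable_fun setT f.
Proof.
by move=> mD Df; apply: (measurable_fun_cvg (h := D)) => // w _; exact: Df.
Qed.

(** The integrand b of the Wiener integral: u^T xi_t is the integral of b(s)^T dW_s over [0, t]. *)
Definition noise_weight (u : 'cV[R]_n) (t s : R) : 'cV[R]_p :=
  (u^T *m E t *m E (- s) *m S)^T.

Lemma sde_noise_cvg u t w : 0 <= t ->
  \sum_(i < m.+1) lform (noise_weight u t (grid t m i))
      (W' (grid t m i.+1) w - W' (grid t m i) w) @[m --> \oo]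
  --> lform u (sde_noise t w).
Proof.
move=> t0.
pose c (s : R) := u^T *m E t *m E (- s) *m S.
pose dc (s : R) := u^T *m E t *m (- (E (- s) *m B)) *m S.
have cd s : mderive c (dc s) s.
  have h1 := mderive_mul (mderive_cst (u^T *m E t) s) (mderive_expmN B s).
  have := mderive_mul h1 (mderive_cst S s).
  by rewrite mul0mx add0r mulmx0 addr0.
have dc_cont s : mcontinuous dc s.
  apply: mcontinuous_mul; last exact: mcontinuous_cst.
  apply: mcontinuousZl; apply: (mderive_mcontinuous (dF := E (- s) *m B *m B)).
  have h1 := mderive_mul (mderive_expmN B s) (mderive_cst B s).
  have := mderive_mul (mderive_cst (- 1%:M : 'M[R]_n) s) h1.
  rewrite mul0mx add0r mulmx0 addr0 mulNmx mul1mx mulNmx opprK.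
  by under eq_fun do rewrite mulNmx mul1mx.
pose F j := prim (fun s => dc s 0 j * W' s w j 0).
have dcW_cont j : continuous (fun s => dc s 0 j * W' s w j 0).
  move=> s; apply: cvgM; first exact: dc_cont.
  exact: (regular_continuous hW').
have lim_j j : \sum_(i < m.+1) c (grid t m i) 0 j *
    (W' (grid t m i.+1) w j 0 - W' (grid t m i) w j 0) @[m --> \oo]
    --> c t 0 j * W' t w j 0 - (F j t - F j 0).
  apply: (@stieltjes_sum_cvg _ (fun s => c s 0 j) (fun s => dc s 0 j)
    (fun s => W' s w j 0) (F j)) => //.
  - by rewrite (regular_start hW') mxE.
  - by move=> s _; exact: cd.
  - by move=> s _; exact: dc_cont.
  - by move=> s _; exact: (regular_continuous hW').
  - by move=> s /andP[s0 _]; exact: prim_deriv.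
have -> : lform u (sde_noise t w) =
    \sum_j (c t 0 j * W' t w j 0 - (F j t - F j 0)).
  rewrite big_split /= sumrN.
  have -> : \sum_j c t 0 j * W' t w j 0 = (u^T *m (S *m W' t w)) 0 0.
    rewrite /c -(mulmxA u^T) expmKN mulmx1 mulmxA [RHS]mxE.
    by apply: eq_bigr => j _.
  rewrite /lform /sde_noise mulmxDr [LHS]mxE addrC; congr (_ + _).
  apply/eqP; rewrite -subr_eq0 opprK; apply/eqP.
  (* Both ways of writing the integral term, through [mprim] and coordinatewise through [F], have
     opposite derivatives, so their sum is constant. *)
  pose G (s : R) := (u^T *m E t) *m mprim (V w) s + (\sum_j F j s)%:M.
  have : G t = G 0.
    apply: mderive0_cst => // s s0.
    have h1 := mderive_mul (mderive_cst (u^T *m E t) s) (mderive_mprim (@V_cont w) s0).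
    have h2 : mderive (fun s => (\sum_j F j s)%:M : 'M[R]_1)
        (\sum_j dc s 0 j * W' s w j 0)%:M s.
      move=> i j; rewrite (ord1 i) (ord1 j) mxE eqxx mulr1n.
      under eq_fun do rewrite mxE eqxx mulr1n.
      rewrite (_ : (fun s => _) = \sum_j (F j)).
        by apply: is_derive_sum => k; exact: prim_deriv.
      by apply/funext => z; rewrite fct_sumE.
    have := mderiveD h1 h2; rewrite mul0mx add0r.
    rewrite (_ : _ + _ = 0)//.
    have -> : (\sum_j dc s 0 j * W' s w j 0)%:M = dc s *m W' s w.
      by rewrite [RHS]mx11_scalar mxE.
    by rewrite /dc /V mulmxN mulNmx mulNmx !mulmxA subrr.
  have D1 (X Y : 'M[R]_1) : (X + Y) 0 0 = X 0 0 + Y 0 0 by rewrite mxE.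
  have D2 (a : R) : (a%:M : 'M[R]_1) 0 0 = a by rewrite mxE eqxx mulr1n.
  move=> /(congr1 (fun A : 'M[R]_1 => A 0 0)).
  rewrite /G mprim0 mulmx0 add0r D1 !D2 => e.
  by rewrite sumrB -e mulmxA; ring.
rewrite (_ : (fun m => _) = fun m => \sum_j \sum_(i < m.+1) c (grid t m i) 0 j *
    (W' (grid t m i.+1) w j 0 - W' (grid t m i) w j 0)).
  exact: cvg_sumR.
apply/funext => m; rewrite exchange_big /=; apply: eq_bigr => i _.
rewrite /lform /noise_weight trmxK mxE; apply: eq_bigr => j _.
by rewrite !mxE.
Qed.

(** Measurability of the pathwise integral in w is inherited from the Stieltjes sums. *)
Lemma measurable_sde_noise t : 0 <= t -> measurable_fun setT (sde_noise t).
Proof.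
move=> t0; apply: measurable_fun_cV => i.
pose u : 'cV[R]_n := delta_mx i 0.
have uE w : sde_noise t w i 0 = lform u (sde_noise t w).
  by rewrite /lform trmx_delta -rowE [RHS]mxE.
under eq_fun do rewrite uE.
apply: (measurable_limit (D := fun m w => \sum_(i < m.+1)
  lform (noise_weight u t (grid t m i)) (W' (grid t m i.+1) w - W' (grid t m i) w))).
  move=> m; apply: measurable_sum => k; apply: measurable_form.
  rewrite (_ : (fun w => _) = fun w =>
    W' (grid t m k.+1) w + (- 1%:M) *m W' (grid t m k) w).
    apply: measurable_funD_cV; first exact: (regular_measurable hW').
    by apply: measurable_fun_linear; exact: (regular_measurable hW').
  by apply/funext => w; rewrite mulNmx mul1mx.
by move=> w; exact: sde_noise_cvg.
Qed.

Lemma sde_solution_noise x :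
  sde_solution Pr W B S x (fun t w => E t *m x + sde_noise t w).
Proof.
have cY w : {within `[0, +oo[, continuous (fun t => E t *m x + sde_noise t w)}.
  by apply: mcontinuous_within => s s0; exact: sde_noise_continuous.
split.
- move=> t t0; apply: measurable_funD_cV; first exact: measurable_cst.
  exact: measurable_sde_noise.
- by apply: aeW => w; exact: cY.
- have [N [mN N0 NW]] := ae_null_set (regular_ae hW').
  apply: (null_set_ae mN N0) => w wN t t0.
  by rewrite -drift_intE// -drift_int_noise// Z_sol NW.
Qed.

(** The noise cancels in the difference D of two solutions, which leaves D' = B D with D 0 = 0, so
    E(- t) D(t) is constant. *)
Lemma sde_solution_uniq x Y : sde_solution Pr W B S x Y ->
  {ae Pr, forall w, forall t, 0 <= t -> Y t w = E t *m x + sde_noise t w}.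
Proof.
move=> hY.
have [N1 [mN1 N10 N1W]] := ae_null_set (regular_ae hW').
have [N2 [mN2 N20 N2Y]] := ae_null_set (sde_continuous hY).
have [N3 [mN3 N30 N3Y]] := ae_null_set (sde_equation hY).
pose N := N1 `|` N2 `|` N3.
have mN : measurable N by apply: measurableU => //; exact: measurableU.
have N0 : Pr N = 0%E by rewrite !null_set_setU//; exact: measurableU.
apply: (null_set_ae mN N0) => w wN t t0.
have {}N1W s : 0 <= s -> W' s w = W s w by apply: N1W => h; apply: wN; left; left.
have cY : {within `[0, +oo[, continuous (Y^~ w)}.
  by apply: N2Y => h; apply: wN; left; right.
have eqY s : 0 <= s -> Y s w = x + drift_int (Y^~ w) s + S *m W s w.
  move=> s0; rewrite drift_intE//.
  by apply: N3Y => // h; apply: wN; right.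
rewrite Z_sol eqY// N1W//; congr (_ + _).
pose D s := x + drift_int (Y^~ w) s - Z x w s.
have Dd s : 0 <= s -> mderive D (B *m D s) s.
  move=> s0; have h1 := mderiveD (mderive_cst x s) (drift_int_deriv cY s0).
  have h2 := mderive_mul (mderive_cst (- 1%:M : 'M[R]_n) s) (Z_deriv x w s0).
  have := mderiveD h1 h2; rewrite mul0mx !add0r mulNmx mul1mx -mulmxBr.
  rewrite eqY// N1W// opprD addrACA subrr addr0.
  by under eq_fun do rewrite mulNmx mul1mx.
have D0 : D 0 = 0.
  by rewrite /D /drift_int mprim0 Z0 addr0 subrr.
have : E (- t) *m D t = E (- 0) *m D 0.
  apply: (mderive0_cst (F := fun s => E (- s) *m D s)) => // s s0.
  have := mderive_mul (mderive_expmN B s) (Dd s s0).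
  by rewrite mulNmx mulmxA addNr.
rewrite D0 mulmx0 => /(congr1 (mulmx (E t))).
by rewrite mulmxA expmKN mul1mx mulmx0 => /eqP; rewrite subr_eq0 => /eqP.
Qed.

(* The variance of u^T xi_t is the integral of |b(s)|^2, which a solution G of
   the Lyapunov equation turns into a difference of quadratic forms. *)
Lemma sde_noise_cos (i0 : 'I_p) (G : 'M[R]_n) u t c : 0 <= t ->
  B *m G + G *m B^T = - (S *m S^T) ->
  expect Pr (fun w => cos (lform u (sde_noise t w) + c)) =
  phi Pr W i0 (lform u (G *m u) - lform u (E t *m G *m (E t)^T *m u)) * cos c.
Proof.
move=> t0 BG.
pose b := noise_weight u t.
pose D m w := \sum_(i < m.+1) lform (b (grid t m i))
  (W' (grid t m i.+1) w - W' (grid t m i) w).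
have mD m : measurable_fun setT (D m).
  apply: measurable_sum => k; apply: measurable_form.
  rewrite (_ : (fun w => _) = fun w =>
    W' (grid t m k.+1) w + (- 1%:M) *m W' (grid t m k) w).
    apply: measurable_funD_cV; first exact: (regular_measurable hW').
    by apply: measurable_fun_linear; exact: (regular_measurable hW').
  by apply/funext => w; rewrite mulNmx mul1mx.
have DE m : expect Pr (fun w => cos (D m w + c)) =
    phi Pr W i0 (\sum_(i < m.+1) (grid t m i.+1 - grid t m i) *
      lform (b (grid t m i)) (b (grid t m i))) * cos c.
  have e := @increments_cos _ _ _ _ _ _ hW i0 (grid t m)
    (fun i => b (grid t m i)) m.+1 c.
  rewrite -e ?grid0//; last by move=> i; exact: grid_le.
  apply: ae_eq_expect.
  - by apply: (bounded_mfun_cos (f := fun w => D m w + c)); exact: measurable_funD.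
  - apply: (bounded_mfun_cos (f := fun w => _ + c)); apply: measurable_funD => //.
    apply: measurable_sum => k; apply: measurable_form.
    by apply: (measurable_increment hW); exact: grid_ge0.
  - have [N [mN N0 NW]] := ae_null_set (regular_ae hW').
    apply: (null_set_ae mN N0) => w wN; congr (cos (_ + _)).
    by apply: eq_bigr => i _; rewrite !NW//; exact: grid_ge0.
(* An antiderivative of |b|^2 by the Lyapunov equation; its values at t and 0 are the two quadratic
   forms of the statement. *)
pose r s : 'M[R]_1 := u^T *m E t *m E (- s) *m G *m (u^T *m E t *m E (- s))^T.
have bb s : lform (b s) (b s) = (u^T *m E t *m E (- s) *m (S *m S^T) *m
    (u^T *m E t *m E (- s))^T) 0 0.
  rewrite /lform /b /noise_weight trmxK [X in _ *m X]trmx_mul.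
  by rewrite !mulmxA.
have rd s : mderive r (lform (b s) (b s))%:M s.
  have h1 := mderive_mul (mderive_cst (u^T *m E t) s) (mderive_expmN B s).
  rewrite mul0mx add0r in h1.
  have h2 := mderive_mul (mderive_mul h1 (mderive_cst G s)) (mderive_tr h1).
  rewrite mulmx0 addr0 in h2.
  rewrite bb -mx11_scalar -[S *m S^T]opprK -BG.
  suff <- : u^T *m E t *m - (E (- s) *m B) *m G *m (u^T *m E t *m E (- s))^T +
      u^T *m E t *m E (- s) *m G *m (u^T *m E t *m - (E (- s) *m B))^T =
      u^T *m E t *m E (- s) *m - (B *m G + G *m B^T) *m (u^T *m E t *m E (- s))^T.
    exact: h2.
  rewrite !mulmxN !mulNmx mulmxDr mulmxDl opprD; congr (- _ + _).
    by rewrite !mulmxA.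
  by rewrite linearN /= mulmxN mulmxA trmx_mul !mulmxA.
have bb_cont s : {for s, continuous (fun s => lform (b s) (b s))}.
  have h : mcontinuous (fun s => u^T *m E t *m E (- s)) s.
    by apply: mcontinuousZl; exact/mderive_mcontinuous/mderive_expmN.
  have h' : mcontinuous (fun s => (u^T *m E t *m E (- s))^T) s.
    move=> i j; rewrite (_ : (fun s => _) =
      fun s => (u^T *m E t *m E (- s)) j i); first exact: h.
    by apply/funext => z; rewrite [LHS]mxE.
  have h2 := mcontinuous_mul (mcontinuous_mul h (@mcontinuous_cst _ _ _ (S *m S^T) s)) h'.
  rewrite (_ : (fun s => lform (b s) (b s)) = fun s =>
    (u^T *m E t *m E (- s) *m (S *m S^T) *m (u^T *m E t *m E (- s))^T) 0 0).
    exact: h2.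
  by apply/funext => z; exact: bb.
have rcvg : \sum_(i < m.+1) (grid t m i.+1 - grid t m i) *
    lform (b (grid t m i)) (b (grid t m i)) @[m --> \oo] --> r t 0 0 - r 0 0 0.
  apply: (@riemann_sum_cvg _ (fun s => lform (b s) (b s)) (fun s => r s 0 0)) => //.
  by move=> s _; have := rd s 0 0; rewrite mxE eqxx mulr1n.
have -> : lform u (G *m u) = r t 0 0.
  by rewrite /r -(mulmxA u^T) expmKN mulmx1 trmxK /lform mulmxA.
have -> : lform u (E t *m G *m (E t)^T *m u) = r 0 0 0.
  rewrite /r oppr0 /E expm0 mulmx1 trmx_mul trmxK /lform.
  by rewrite !mulmxA.
have h1 : expect Pr (fun w => cos (D m w + c)) @[m --> \oo] -->
    expect Pr (fun w => cos (lform u (sde_noise t w) + c)).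
  apply: (@expect_lim _ _ _ Pr (fun m w => cos (D m w + c)) _ 1).
  - move=> m; have [] // := bounded_mfun_cos (f := fun w => D m w + c) _.
    exact: measurable_funD.
  - by move=> m w; rewrite ler_norml cos_geN1 cos_le1.
  - move=> w; apply: continuous_cvg; first exact: continuous_cos.
    by apply: cvgD; [exact: sde_noise_cvg|exact: cvg_cst].
have h2 := cvgMr_tmp (b := cos c) (cvg_phi hW (i0 := i0) rcvg).
move: h1; under eq_fun do rewrite DE; move=> h1.
exact: (cvg_unique _ h1 (h2 _)).
Qed.

End solution.
End linear_sde.

(** * Invariance under the flow *)

Section normal_shift.
Context {R : realType}.

Lemma lebesgue_measure_shift (c : R) (A : set R) : measurable A ->
  lebesgue_measure A = lebesgue_measure ((fun x => c + x) @^-1` A).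
Proof.
move=> mA.
have mf : measurable_fun setT (fun x : measurableTypeR R => c + x : measurableTypeR R).
  by apply: measurable_funD => //; exact: measurable_id.
apply: (@lebesgue_measure_unique R (pushforward lebesgue_measure (mfun_of mf))) => //.
move=> X [[a b] _ <-] /=; rewrite /pushforward.
rewrite (_ : _ @^-1` _ = `]a - c, b - c]%classic); last first.
  apply/seteqP; split => x /=; rewrite !in_itv/= ltrBlDl lerBrDl//.
by rewrite !lebesgue_measure_itv/= !lte_fin ltrD2r -!EFinB opprB addrA subrK.
Qed.

Lemma normal_law_shift (c v : R) (A : set R) : measurable A -> 0 <= v ->
  normal_law 0 v ((fun x => c + x) @^-1` A) = normal_law c v A.
Proof.
move=> mA v0; rewrite /normal_law; case: ifPn => [_|vn0].
  rewrite !diracE (_ : (0 \in _) = (c \in A))//.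
  by apply/idP/idP; rewrite !inE /= addr0.
have s0 : Num.sqrt v != 0 by rewrite gt_eqF// sqrtr_gt0 lt_def vn0.
have mf : measurable_fun setT (fun x : measurableTypeR R => c + x : measurableTypeR R).
  by apply: measurable_funD => //; exact: measurable_id.
have mg : measurable_fun A (fun x : measurableTypeR R => (normal_pdf c (Num.sqrt v) x)%:E).
  apply/measurable_EFinP; apply: measurable_funTS.
  exact: measurable_normal_pdf.
have g0 : {in A, forall x, (0 <= (normal_pdf c (Num.sqrt v) x)%:E)%E}.
  by move=> x _; rewrite lee_fin normal_pdf_ge0.
have := @ge0_integral_pushforward _ _ _ _ R _ mf lebesgue_measure A _ mA mg g0.
rewrite [X in X = _](eq_measure_integral lebesgue_measure); last first.
  by move=> B mB _; rewrite [RHS](lebesgue_measure_shift c).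
rewrite /normal_prob => ->; apply: eq_integral => x _ /=; congr EFin.
rewrite !normal_pdfE//; congr (_ * _); rewrite /normal_fun subr0.
by rewrite addrAC subrr add0r.
Qed.

End normal_shift.

Section invariance.
Context {R : realType} d (Omega : measurableType d) (Pr : probability Omega R).
Context p (W : R -> Omega -> 'cV[R]_p) (hW : brownian_motion Pr W) (i0 : 'I_p).

Let ph := phi Pr W i0.

Lemma bounded_lform_cos n (u : 'cV[R]_n) (c : R) :
  bounded_mfun (fun x : 'cV[R]_n => cos (lform u x + c)).
Proof. exact/trig_closure_bounded/trig_cos. Qed.

(** The working form of N(m, G), with [phi] for the Gaussian characteristic function; G may be
    singular, as diag (0, hatSigma) is. *)
Definition cos_gaussian n (mu : probability 'cV[R]_n R) (m : 'cV[R]_n) (G : 'M[R]_n) :=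
  forall u c, expect mu (fun x => cos (lform u x + c)) =
    ph (lform u (G *m u)) * cos (lform u m + c).

Lemma cos_gaussian_uniq n (mu nu : probability 'cV[R]_n R) m G :
  cos_gaussian mu m G -> cos_gaussian nu m G ->
  forall A, measurable A -> mu A = nu A.
Proof.
by move=> hmu hnu; apply: eq_probability_cos => u c; rewrite hmu hnu.
Qed.

Lemma lformDr n (u x y : 'cV[R]_n) : lform u (x + y) = lform u x + lform u y.
Proof. by rewrite /lform mulmxDr mxE. Qed.

Lemma lform_mulmx m n (u : 'cV[R]_m) (A : 'M[R]_(m, n)) (x : 'cV[R]_n) :
  lform u (A *m x) = lform (A^T *m u) x.
Proof. by rewrite /lform trmx_mul trmxK mulmxA. Qed.

(** For fixed u, the law of u^T x is compared with that of u^T m plus a Brownian increment of the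
    same variance: their cosine transforms agree, and translation reduces to the centred
    increment. *)
Lemma cos_gaussian_normal n (mu : probability 'cV[R]_n R) m G :
  (forall u, 0 <= lform u (G *m u)) -> cos_gaussian mu m G -> gaussian mu m G.
Proof.
move=> G0 hmu u A mA; rewrite -mulmxA -/(lform u m) -/(lform u (G *m u)).
set v := lform u (G *m u).
have v0 : 0 <= v by exact: G0.
have mu_form : measurable_fun setT (fun x : 'cV[R]_n => lform u x).
  by apply: measurable_form; exact: measurable_id.
pose e0 : 'cV[R]_p := Num.sqrt v *: delta_mx i0 0.
have e0E : lform e0 e0 = v.
  rewrite lformZl lformZr /lform trmx_delta -rowE !mxE !eqxx mulr1 -expr2.
  by rewrite sqr_sqrtr.
pose Y w := lform u m + lform e0 (W 1 w - W 0 w).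
have mY0 : measurable_fun setT (fun w => lform e0 (W 1 w - W 0 w)).
  by apply: measurable_form; exact: (measurable_increment hW).
have mY : measurable_fun setT Y by exact: measurable_funD.
have cosY (s c : R) : expect Pr (fun w => cos (s * Y w + c)) =
    ph (s * (s * v)) * cos (s * lform u m + c).
  have := @increments_cos _ _ _ _ _ _ hW i0 (fun i => i%:R) (fun=> s *: e0) 1
    (s * lform u m + c) (lexx 0).
  have ti i : (i%:R : R) <= i.+1%:R by rewrite ler_nat.
  move=> /(_ ti); rewrite big_ord1 subr0 mul1r lformZl lformZr e0E => <-.
  congr expect; apply/funext => w; congr cos.
  by rewrite big_ord1 /Y lformZl; ring.
transitivity (Pr (Y @^-1` A)).
  pose muR : probability R R := law mu mu_form.
  pose YR : probability R R := law Pr mY.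
  suff : forall s c, expect muR (fun x => cos (s * x + c)) =
                     expect YR (fun x => cos (s * x + c)).
    (* Reals are viewed as vectors of size 1 so that [eq_probability_cos] applies on the line. *)
    move=> H; pose toV (x : R) : 'cV[R]_1 := const_mx x.
    have mV : measurable_fun setT toV.
      by apply: measurable_fun_cV => i; under eq_fun do rewrite mxE; exact: measurable_id.
    pose B := (fun x : 'cV[R]_1 => x 0 0) @^-1` A.
    have mB : measurable B.
      by rewrite /B -[_ @^-1` _]setTI; exact: measurable_cV_coord.
    have E (Q : probability R R) : law Q mV B = Q A.
      rewrite lawE; congr (Q _).
      by apply/seteqP; split => x; rewrite /B /= mxE.
    have : law muR mV B = law YR mV B.
      apply: (eq_probability_cos _ mB) => s c.
      rewrite (@expect_law _ _ _ muR _ _ _ mV _ (bounded_lform_cos _ _)).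
      rewrite (@expect_law _ _ _ YR _ _ _ mV _ (bounded_lform_cos _ _)).
      have E2 : (fun x : 'cV[R]_1 => cos (lform s x + c)) \o toV =
          fun x => cos (s 0 0 * x + c).
        by apply/funext => x /=; rewrite /lform mxE big_ord1 !mxE.
      by rewrite E2.
    by rewrite !E.
  move=> s c.
  have hb : bounded_mfun (fun x : R => cos (s * x + c)).
    apply: (bounded_mfun_comp (X := fun x : R => s * x + c));
      last exact: bounded_mfun_cosR.
    apply: measurable_funD => //; apply: measurable_funM => //; exact: measurable_id.
  rewrite (@expect_law _ _ _ mu _ _ _ mu_form _ hb) (@expect_law _ _ _ Pr _ _ _ mY _ hb).
  rewrite [RHS]cosY -[RHS](_ : expect mu (fun x => cos (lform (s *: u) x + c)) = _).
    by congr expect; apply/funext => x /=; rewrite lformZl.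
  by rewrite hmu -scalemxAr lformZr !lformZl.
rewrite -normal_law_shift//.
rewrite (_ : Y @^-1` A = (fun w => lform e0 (W 1 w - W 0 w)) @^-1`
  ((fun x => lform u m + x) @^-1` A))//.
rewrite (increment_normal hW _ (lexx 0) ler01).
  by congr (normal_law 0 _ _); rewrite subr0 mul1r e0E.
by rewrite -[_ @^-1` _]setTI;
  apply: (measurable_funD (measurable_cst (lform u m)) (@measurable_id _ _ _)).
Qed.

(** The increments of coordinate [i0] over [i, i + 1] provide n independent standard normals. *)
Lemma exists_cos_gaussian n (m : 'cV[R]_n) (L : 'M[R]_n) :
  exists mu : probability 'cV[R]_n R, cos_gaussian mu m (L *m L^T).
Proof.
pose g (w : Omega) : 'cV[R]_n := \col_(i < n) (W i.+1%:R w - W i%:R w) i0 0.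
have mg : measurable_fun setT g.
  apply: measurable_fun_cV => i; under eq_fun do rewrite mxE.
  apply: (measurableT_comp (measurable_cV_coord i0)).
  by apply: (measurable_increment hW).
have mX : measurable_fun setT (fun w => m + L *m g w).
  apply: measurable_funD_cV; first exact: measurable_cst.
  exact: measurable_fun_linear.
exists (law Pr mX) => u c.
rewrite expect_law; last exact: bounded_lform_cos.
pose v := L^T *m u.
(* [increments_cos] wants weights indexed by all naturals, hence the value 0 beyond n. *)
pose b (i : nat) : 'cV[R]_p := oapp (fun j : 'I_n => v j 0) 0 (insub i) *: delta_mx i0 0.
have bE (i : 'I_n) : b i = v i 0 *: delta_mx i0 0 by rewrite /b valK.
have := @increments_cos _ _ _ _ _ _ hW i0 (fun i => i%:R) b n (lform u m + c) (lexx 0).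
have ti i : (i%:R : R) <= i.+1%:R by rewrite ler_nat.
move=> /(_ ti).
have -> : \sum_(i < n) (i.+1%:R - i%:R) * lform (b i) (b i) =
    lform u (L *m L^T *m u).
  rewrite -mulmxA lform_mulmx -/v [RHS]/lform [RHS]mxE; apply: eq_bigr => i _.
  rewrite bE -natrB// subSnn mul1r lformZl lformZr [v^T _ _]mxE.
  by rewrite /lform trmx_delta -rowE !mxE !eqxx mulr1.
move=> <-; congr expect; apply/funext => w /=; congr cos.
rewrite lformDr lform_mulmx -/v.
have -> : lform v (g w) = \sum_(i < n) lform (b i) (W i.+1%:R w - W i%:R w).
  rewrite [LHS]/lform [LHS]mxE; apply: eq_bigr => i _.
  by rewrite bE lformZl /lform trmx_delta -rowE !mxE.
by ring.
Qed.

Section transition.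
Variables (n : nat) (B : 'M[R]_n) (S : 'M[R]_(n, p)).
Variables (W' : R -> Omega -> 'cV[R]_p) (hW' : regular_version Pr W W').

Let E := expm B.
Let xi := sde_noise B S W'.

Lemma transition_prob x X t A : sde_solution Pr W B S x X -> 0 <= t -> measurable A ->
  Pr [set w | A (X t w)] = Pr [set w | A (E t *m x + xi t w)].
Proof.
move=> hX t0 mA.
have m1 : measurable (X t @^-1` A).
  by rewrite -[_ @^-1` _]setTI; exact: (sde_measurable hX).
have mf : measurable_fun setT (fun w => E t *m x + xi t w).
  apply: measurable_funD_cV; first exact: measurable_cst.
  by rewrite /xi; have := measurable_sde_noise B S hW' t0; apply.
have m2 : measurable ((fun w => E t *m x + xi t w) @^-1` A).
  by rewrite -[_ @^-1` _]setTI; exact: mf.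
have : expect Pr \1_(X t @^-1` A) = expect Pr \1_((fun w => E t *m x + xi t w) @^-1` A).
  apply: ae_eq_expect; [exact: bounded_mfun_indic..|].
  have [N [mN N0 NX]] := ae_null_set (sde_solution_uniq hW' hX).
  apply: (null_set_ae mN N0) => w wN; rewrite !indicE /in_mem /= /in_set /preimage/=.
  by rewrite NX.
rewrite !expect_indic// => e.
rewrite -[LHS]fineK; last exact: fin_num_measure.
by rewrite -[RHS]fineK; [congr EFin; exact: e|exact: fin_num_measure].
Qed.

Lemma measurable_flow t : 0 <= t ->
  measurable_fun setT (fun z : 'cV[R]_n * Omega => E t *m z.1 + xi t z.2).
Proof.
move=> t0; apply: measurable_funD_cV.
  exact: (measurable_fun_linear _ measurable_fst).
apply: (measurableT_comp (f := xi t)); last exact: measurable_snd.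
by rewrite /xi; have := measurable_sde_noise B S hW' t0; apply.
Qed.

(** Under the product measure the initial point is independent of the noise, so nu p_t becomes the
    law of E(t) x + xi_t. *)
Lemma integral_transition (nu : probability 'cV[R]_n R) t A (t0 : 0 <= t) :
  measurable A ->
  (\int[nu]_x Pr [set w | (A (E t *m x + xi t w))%R])%E =
  law (nu \x Pr)%E (measurable_flow t0) A.
Proof.
move=> mA; rewrite lawE /=; apply: eq_integral => x _; congr (Pr _).
by apply/seteqP; split => w; rewrite /xsection/= inE.
Qed.

Variable G : 'M[R]_n.
Hypothesis BG : B *m G + G *m B^T = - (S *m S^T).

Let Gt t := E t *m G *m (E t)^T.
Let q t u := lform u (G *m u) - lform u (Gt t *m u).

Lemma expect_flow (nu : probability 'cV[R]_n R) t (t0 : 0 <= t) u c :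
  expect (law (nu \x Pr)%E (measurable_flow t0)) (fun x => cos (lform u x + c)) =
  ph (q t u) * expect nu (fun x => cos (lform u (E t *m x) + c)).
Proof.
rewrite expect_law; last exact: bounded_lform_cos.
rewrite expect_prod; last first.
  apply: (bounded_mfun_comp (measurable_flow t0)); exact: bounded_lform_cos.
rewrite -expectZ; last first.
  have := bounded_lform_cos ((E t)^T *m u) c.
  by under eq_fun do rewrite -lform_mulmx.
congr expect; apply/funext => x /=.
rewrite -(sde_noise_cos hW hW' i0 u _ t0 BG).
congr expect; apply/funext => w; congr cos.
by rewrite lformDr /xi; ring.
Qed.

(** The form u^T E(s) G E(s)^T u has derivative - |S^T E(s)^T u|^2. Nonnegativity is what allows
    [phiD] to be used in [flow_invariant]. *)
Lemma flow_variance_ge0 t u : 0 <= t -> 0 <= q t u.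
Proof.
move=> t0; rewrite subr_ge0.
pose g s := lform u (Gt s *m u).
pose dg s := lform u (E s *m (B *m G + G *m B^T) *m (E s)^T *m u).
have gd s : is_derive s (1 : R) g (dg s).
  have h1 := mderive_mul (mderive_mul (mderive_expm B s) (mderive_cst G s))
    (mderive_tr (mderive_expm B s)).
  have h2 := mderive_mul (mderive_mul (mderive_cst u^T s) h1) (mderive_cst u s).
  rewrite mul0mx add0r mulmx0 addr0 mulmx0 addr0 in h2.
  have := h2 0 0.
  rewrite (_ : (fun s => _) = g); last first.
    by apply/funext => z; rewrite /g /lform /Gt !mulmxA.
  rewrite (_ : _ 0 0 = dg s)// /dg /lform mulmxA; congr (fun_of_matrix _ 0 0).
  congr (_ *m _); congr (_ *m _); rewrite mulmxDr mulmxDl trmx_mul.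
  by rewrite !mulmxA.
have dg0 s : dg s <= 0.
  rewrite /dg BG mulmxN mulNmx mulNmx /lform mulmxN mxE oppr_le0.
  rewrite (_ : u^T *m _ = (S^T *m (E s)^T *m u)^T *m (S^T *m (E s)^T *m u)).
    exact: (lform_ge0 (S^T *m (E s)^T *m u)).
  by rewrite !trmx_mul !trmxK !mulmxA.
have gnincr : forall x y : R, 0 <= x -> x <= y -> g y <= g x.
  apply: ler0_derive1_nincry => [x _|x _|].
  - by have [] := gd x.
  - by rewrite derive1E; have [_ ->] := gd x.
  - by apply: derivable_within_continuous => x _; have [] := gd x.
by have := gnincr 0 t (lexx 0) t0; rewrite /g /Gt /E expm0 trmx1 mul1mx mulmx1.
Qed.

Lemma flow_invariant (mu : probability 'cV[R]_n R) m t (t0 : 0 <= t) A :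
  cos_gaussian mu m G -> B *m m = 0 -> (forall u, 0 <= lform u (G *m u)) ->
  measurable A -> law (mu \x Pr)%E (measurable_flow t0) A = mu A.
Proof.
move=> hmu Bm G0; apply: eq_probability_cos => u c.
rewrite expect_flow hmu.
under eq_fun do rewrite lform_mulmx.
rewrite hmu mulrA; congr (_ * _); last by rewrite -lform_mulmx expm_fix.
have e : lform ((E t)^T *m u) (G *m ((E t)^T *m u)) = lform u (Gt t *m u).
  by rewrite -lform_mulmx /Gt !mulmxA.
have v0 : 0 <= lform u (Gt t *m u) by rewrite -e; exact: G0.
rewrite e /ph -(phiD hW)//; last exact: flow_variance_ge0.
by rewrite /q subrK.
Qed.

(** By invariance, [step] holds at every integer time k with a left side free of k; then k tends to
    infinity. As [expect_lim] wants convergence at every point, [pr] sends each point into the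
    region attracted to m while being the identity nu-almost everywhere. *)
Lemma flow_invariant_uniq (nu : probability 'cV[R]_n R) m (pr : 'cV[R]_n -> 'cV[R]_n) :
  (forall t (t0 : 0 <= t) A, measurable A ->
    law (nu \x Pr)%E (measurable_flow t0) A = nu A) ->
  measurable_fun setT pr -> {ae nu, forall x, pr x = x} ->
  (forall x u, lform u (E t *m pr x) @[t --> +oo] --> lform u m) ->
  (forall u, lform u (Gt t *m u) @[t --> +oo] --> (0 : R)) ->
  cos_gaussian nu m G.
Proof.
move=> inv mpr nupr prm Gt0 u c.
have k0 k : 0 <= k%:R :> R by [].
have kinfty : (k%:R : R) @[k --> \oo] --> +oo%R by exact: cvgr_idn.
pose f k x := cos (lform u (E k%:R *m pr x) + c).
have hf k : bounded_mfun (f k).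
  apply: (bounded_mfun_cos (f := fun x => _ + c)); apply: measurable_funD => //.
  by apply: measurable_form; exact: measurable_fun_linear.
have step k : expect nu (fun x => cos (lform u x + c)) = ph (q k%:R u) * expect nu (f k).
  transitivity (ph (q k%:R u) * expect nu (fun x => cos (lform u (E k%:R *m x) + c))).
    rewrite -(expect_flow nu (k0 k)); apply: eq_expect; first exact: bounded_lform_cos.
    by move=> A mA; rewrite inv.
  congr (_ * _); apply: ae_eq_expect => //.
    have := bounded_lform_cos ((E k%:R)^T *m u) c.
    by under eq_fun do rewrite -lform_mulmx.
  have [N [mN N0 NX]] := nupr; exists N; split=> // x /= h; apply: NX => /= e; apply: h.
  by rewrite /f e.
have h1 : expect nu (f k) @[k --> \oo] --> expect nu (fun=> cos (lform u m + c)).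
  apply: (@expect_lim _ _ _ nu f _ 1).
  - by move=> k; have [] := hf k.
  - by move=> k x; rewrite ler_norml cos_geN1 cos_le1.
  - move=> x; apply: continuous_cvg; first exact: continuous_cos.
    apply: cvgD; last exact: cvg_cst.
    by have /cvg_pinftyP := prm x u; apply.
have h2 : ph (q k%:R u) @[k --> \oo] --> ph (lform u (G *m u)).
  apply: (cvg_phi hW); rewrite -[X in _ --> X]subr0; apply: cvgB; first exact: cvg_cst.
  by have /cvg_pinftyP := Gt0 u; apply.
have h3 := cvgM h2 h1; rewrite expect_cst in h3.
have {}h3 := cvg_lim (@Rhausdorff R) (h3 _).
rewrite -h3; apply/esym/cvg_lim => //.
rewrite (_ : (_ \* _) = fun=> expect nu (fun x => cos (lform u x + c))).
  exact: cvg_cst.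
by apply/funext => k; exact/esym/step.
Qed.

End transition.
End invariance.

(** * The frozen dynamics *)

Section cV_blocks.
Context {R : realType}.

Lemma measurable_col_mx d (T : measurableType d) k l (f : T -> 'cV[R]_k)
    (g : T -> 'cV[R]_l) : measurable_fun setT f -> measurable_fun setT g ->
  measurable_fun setT (fun x => col_mx (f x) (g x)).
Proof.
move=> mf mg; apply: measurable_fun_cV => i; under eq_fun do rewrite mxE.
case: (fintype.split i) => j.
  exact: (measurableT_comp (measurable_cV_coord j)).
exact: (measurableT_comp (measurable_cV_coord j)).
Qed.

Lemma measurable_usubmx k l :
  measurable_fun setT (usubmx : 'cV[R]_(k + l) -> 'cV[R]_k).
Proof.
apply: measurable_fun_cV => i; under eq_fun do rewrite mxE.
exact: measurable_cV_coord.
Qed.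

Lemma measurable_dsubmx k l :
  measurable_fun setT (dsubmx : 'cV[R]_(k + l) -> 'cV[R]_l).
Proof.
apply: measurable_fun_cV => i; under eq_fun do rewrite mxE.
exact: measurable_cV_coord.
Qed.

Lemma measurable_cV_set1 n (y : 'cV[R]_n) : measurable [set y].
Proof.
rewrite (_ : [set y] = \bigcap_i ((fun x : 'cV[R]_n => x i 0) @^-1` [set y i 0])).
  apply: fin_bigcap_measurable => // i _.
  by rewrite -[_ @^-1` _]setTI; exact: measurable_cV_coord.
apply/seteqP; split=> [x -> i _//|x xy /=].
by apply/matrixP => i j; rewrite (ord1 j); exact: (xy i).
Qed.

Lemma cV_product_dirac k l (y : 'cV[R]_k) (mu : probability 'cV[R]_l R) B :
  measurable B -> cV_product \d_y mu B = mu ((col_mx y) @^-1` B).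
Proof.
move=> mB; rewrite /cV_product /pushforward.
have mC : measurable ((fun p : 'cV[R]_k * 'cV[R]_l => col_mx p.1 p.2) @^-1` B).
  rewrite -[_ @^-1` _]setTI.
  by apply: (measurable_col_mx measurable_fst measurable_snd).
rewrite /product_measure1 /= integral_dirac//; last exact: measurable_fun_xsection.
rewrite diracT mul1e; congr (mu _).
by apply/seteqP; split => x; rewrite /xsection /= inE.
Qed.

Lemma lform_col_mx k l (u : 'cV[R]_(k + l)) (x : 'cV[R]_k) (y : 'cV[R]_l) :
  lform u (col_mx x y) = lform (usubmx u) x + lform (dsubmx u) y.
Proof. by rewrite /lform -{1}(vsubmxK u) tr_col_mx mul_row_col mxE. Qed.

End cV_blocks.

Section degenerate_sde.
Context {R : realType} d (Omega : measurableType d) (Pr : probability Omega R).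
Context p (W : R -> Omega -> 'cV[R]_p) (hW : brownian_motion Pr W) (i0 : 'I_p).

Lemma cos_gaussian_invariant n (B : 'M[R]_n) (S : 'M[R]_(n, p)) G m mu :
  B *m G + G *m B^T = - (S *m S^T) -> B *m m = 0 ->
  (forall u, 0 <= lform u (G *m u)) -> cos_gaussian Pr W i0 mu m G ->
  invariant_measure Pr W B S mu.
Proof.
move=> BG Bm G0 hmu; have [W' hW'] := exists_regular_version hW.
exists (fun x t w => expm B t *m x + sde_noise B S W' t w); split.
  by move=> x; exact: sde_solution_noise.
move=> t A t0 mA; rewrite (integral_transition B S hW' mu t0 mA).
exact: (flow_invariant hW hW' BG t0 hmu).
Qed.

Lemma invariant_cos_gaussian n (B : 'M[R]_n) (S : 'M[R]_(n, p)) G m nu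
    (pr : 'cV[R]_n -> 'cV[R]_n) :
  B *m G + G *m B^T = - (S *m S^T) -> invariant_measure Pr W B S nu ->
  measurable_fun setT pr -> {ae nu, forall x, pr x = x} ->
  (forall x u, lform u (expm B t *m pr x) @[t --> +oo] --> lform u m) ->
  (forall u, lform u (expm B t *m G *m (expm B t)^T *m u) @[t --> +oo] --> (0 : R)) ->
  cos_gaussian Pr W i0 nu m G.
Proof.
move=> BG [X [hX inv]] mpr nupr prm G0; have [W' hW'] := exists_regular_version hW.
apply: (@flow_invariant_uniq _ _ _ _ _ _ hW i0 _ _ _ _ hW' _ BG _ _ _ _
  mpr nupr prm G0) => t t0 A mA.
rewrite -(integral_transition B S hW' nu t0 mA) -(inv t A t0 mA).
by apply: eq_integral => x _; rewrite (transition_prob hW' (hX x) t0 mA).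
Qed.

Variables (k l : nat) (N : 'M[R]_(l, k)) (M : 'M[R]_l) (C : 'M[R]_(l, p)).

Let B : 'M[R]_(k + l) := block_mx 0 0 N M.
Let S : 'M[R]_(k + l, p) := Num.sqrt 2 *: col_mx 0 C.

Lemma sde_frozen y Y : sde_solution Pr W B S y Y ->
  {ae Pr, forall w, forall t, 0 <= t -> usubmx (Y t w) = usubmx y}.
Proof.
move=> hY; have [Z [mZ Z0 ZY]] := ae_null_set (sde_equation hY).
apply: (null_set_ae mZ Z0) => w wZ t t0; rewrite (ZY _ wZ _ t0).
have B0 (x : 'cV[R]_(k + l)) : B *m x = col_mx 0 (N *m usubmx x + M *m dsubmx x).
  by rewrite -{1}(vsubmxK x) mul_block_col !mul0mx addr0.
rewrite !linearD /= -scalemxAl linearZ /= mul_col_mx col_mxKu mul0mx scaler0 addr0.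
rewrite [X in _ + X](_ : _ = 0) ?addr0//.
apply/matrixP => i j; rewrite !mxE.
under eq_Rintegral do rewrite B0 col_mxEu mxE.
by rewrite /Rintegral integral0.
Qed.

Variable G : 'M[R]_l.
Hypotheses (hM : hurwitz M) (G_pos : posdef G).
Hypothesis MG : M *m G + G *m M^T = (- 2) *: (C *m C^T).

Let Gb : 'M[R]_(k + l) := block_mx 0 0 0 G.
Let hatm y : 'cV[R]_l := - invmx M *m N *m y.

Let G_ge0 u : 0 <= lform u (G *m u).
Proof. by rewrite /lform mulmxA; apply: lyapunov_ge0 MG u; exact: hurwitz_decay. Qed.

Let lform_Gb u : lform u (Gb *m u) = lform (dsubmx u) (G *m dsubmx u).
Proof.
by rewrite -{2}(vsubmxK u) mul_block_col !mul0mx !add0r lform_col_mx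
  /lform mulmx0 mxE add0r.
Qed.

Let BG : B *m Gb + Gb *m B^T = - (S *m S^T).
Proof.
rewrite /B /Gb tr_block_mx !mulmx_block !trmx0 !mul0mx !mulmx0 !addr0 !add0r.
rewrite add_block_mx !addr0 MG /S linearZ /= -scalemxAl -scalemxAr scalerA.
rewrite -expr2 sqr_sqrtr// tr_col_mx mul_col_row !trmx0 !mul0mx mulmx0.
by rewrite scale_block_mx opp_block_mx !scaler0 !oppr0 scaleNr.
Qed.

Let B_mean y : B *m col_mx y (hatm y) = 0.
Proof.
rewrite mul_block_col !mul0mx addr0 /hatm !mulNmx mulmxN -mulmxA mulKVmx ?subrr ?col_mx0//.
exact/stable_unit/hurwitz_decay.
Qed.

Lemma frozen_invariant_measure (y : 'cV[R]_k) :
  exists (hatmu : probability 'cV[R]_l R) (mu : probability 'cV[R]_(k + l) R),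
  [/\ gaussian hatmu (hatm y) G,
      (forall A, measurable A -> mu A = cV_product \d_y hatmu A),
      invariant_measure Pr W B S mu
    & forall nu : probability 'cV[R]_(k + l) R, invariant_measure Pr W B S nu ->
        nu [set x | usubmx x = y] = 1%E ->
        forall A, measurable A -> nu A = mu A].
Proof.
have [L LG] := cholesky G_pos.
have [hatmu] := exists_cos_gaussian hW i0 (hatm y) L; rewrite LG => hmu.
have my : measurable_fun setT (fun x : 'cV[R]_l => col_mx y x).
  by apply: measurable_col_mx; [exact: measurable_cst|exact: measurable_id].
pose mu := law hatmu my.
have mu_cos : cos_gaussian Pr W i0 mu (col_mx y (hatm y)) Gb.
  move=> u c; rewrite expect_law; last exact: bounded_lform_cos.
  have -> : lform u (col_mx y (hatm y)) + c =
      lform (dsubmx u) (hatm y) + (lform (usubmx u) y + c).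
    by rewrite lform_col_mx; ring.
  rewrite lform_Gb -hmu; congr expect.
  by apply/funext => x /=; rewrite lform_col_mx; congr cos; ring.
exists hatmu, mu; split.
- by apply: (cos_gaussian_normal hW) hmu.
- by move=> A mA; rewrite cV_product_dirac.
- by apply: cos_gaussian_invariant BG (B_mean y) _ mu_cos => u; rewrite lform_Gb.
move=> nu nu_inv nuy; apply: cos_gaussian_uniq _ mu_cos.
apply: (invariant_cos_gaussian (pr := fun x => col_mx y (dsubmx x)) BG nu_inv).
- by apply: measurable_col_mx; [exact: measurable_cst|exact: measurable_dsubmx].
- exists (~` [set x | usubmx x = y]); split.
  + apply: measurableC; rewrite -[X in measurable X]setTI.
    exact: (measurable_usubmx measurableT (measurable_cV_set1 y)).
  + rewrite probability_setC; first by rewrite nuy subee.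
    rewrite -[X in measurable X]setTI.
    exact: (measurable_usubmx measurableT (measurable_cV_set1 y)).
  + by move=> x /= xy e; apply: xy; rewrite -e vsubmxK.
- move=> x u.
  (* Every point of the fibre is the fixed point of the flow plus a vector in {0} x R^l, where the
     flow decays. *)
  have -> : col_mx y (dsubmx x) =
      col_mx y (hatm y) + col_mx 0 1%:M *m (dsubmx x - hatm y).
    by rewrite mul_col_mx mul0mx mul1mx add_col_mx addr0 addrC subrK.
  have h := tends0_mull u^T (tends0_mulr (dsubmx x - hatm y) (hurwitz_block_decay N hM)).
  have := cvgD (cvg_cst (lform u (col_mx y (hatm y)))) (h 0 0); rewrite addr0 => H.
  under eq_fun do rewrite mulmxDr expm_fix// lformDr mulmxA.
  exact: H.
- move=> u.
  have := tends0_mull u^T (tends0_mulr u (tends0_conj G (hurwitz_block_decay N hM))).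
  move=> /(_ 0 0) H.
  (* Factoring through [col_mx 0 1%:M] leaves only the decaying part of E(t) on both sides of G. *)
  have GbE : Gb = col_mx 0 1%:M *m G *m (col_mx 0 1%:M)^T.
    by rewrite tr_col_mx trmx0 trmx1 mul_col_mx mul0mx mul1mx mul_col_row
      !mul0mx mulmx0 mulmx1.
  under eq_fun do rewrite GbE.
  rewrite (_ : (fun t => _) = fun t => (u^T *m (expm B t *m col_mx 0 1%:M *m G *m
    (expm B t *m col_mx 0 1%:M)^T *m u)) 0 0)//.
  by apply/funext => t; rewrite /lform [in RHS]trmx_mul !mulmxA.
Qed.

End degenerate_sde.

(** * Reduction of the projected dynamics to block form *)

Unset Implicit Arguments.

Theorem proposition4p2 (R : realType) (k l n1 n2 : nat)
    (hk : (0 < k)%N) (hl : (0 < l)%N)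
    (d : measure_display) (Omega : measurableType d) (Pr : probability Omega R)
    (W : R -> Omega -> 'cV[R]_(n1 + n2)) (hW : brownian_motion Pr W)
    (M : 'M[R]_(k + l)) (C : 'M[R]_(k + l, n1 + n2))
    (hM : hurwitz M) (hMC : controllable M C)
    (Sigma : 'M[R]_(k + l)) (hSigma : lyapunov_solution M C Sigma)
    (K : 'M[R]_(k + l)) (hK : hurwitz (- ulsubmx K)) :
  let A := C *m C^T in
  let J := 2^-1 *: (M *m Sigma - Sigma *m M^T) in
  let alpha := - dlsubmx K *m invmx (ulsubmx K) in
  let hatM := alpha *m ursubmx M + drsubmx M in
  let hatC := row_mx (alpha *m ulsubmx C + dlsubmx C)
                     (alpha *m ursubmx C + drsubmx C) in
  let P : 'M[R]_(k + l) := block_mx 0 0 alpha 1%:M in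
  let drift := P *m (J - A) *m invmx Sigma in
  let noise := Num.sqrt 2 *: (P *m C) in
  let hatm (y : 'cV[R]_k) :=
    - invmx hatM *m (alpha *m ulsubmx M + dlsubmx M) *m y in
  let mc (b : 'cV[R]_k) :=
    dlsubmx Sigma *m invmx (ulsubmx Sigma) *m b in
  let Sigmac := drsubmx Sigma -
    dlsubmx Sigma *m invmx (ulsubmx Sigma) *m ursubmx Sigma in
  hurwitz hatM -> controllable hatM hatC ->
  exists hatSigma : 'M[R]_l,
    [/\ unique (lyapunov_solution hatM hatC) hatSigma,
        (forall (y : 'cV[R]_(k + l)) (Y : R -> Omega -> 'cV[R]_(k + l)),
           sde_solution Pr W drift noise y Y ->
           {ae Pr, forall w, forall t, 0 <= t -> usubmx (Y t w) = usubmx y}),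
        (forall y1 : 'cV[R]_k,
           exists (hatmu : probability 'cV[R]_l R)
                  (mu : probability 'cV[R]_(k + l) R),
           [/\ gaussian hatmu (hatm y1) hatSigma,
               (forall B, measurable B -> mu B = cV_product \d_y1 hatmu B),
               invariant_measure Pr W drift noise mu
             & forall nu : probability 'cV[R]_(k + l) R,
                 invariant_measure Pr W drift noise nu ->
                 nu [set y | usubmx y = y1] = 1%E ->
                 forall B, measurable B -> nu B = mu B]),
        (hatSigma = Sigmac <->
         skew_symmetric
           ((alpha + dlsubmx Sigma *m invmx (ulsubmx Sigma)) *m
            ((ulsubmx J + ulsubmx A) *m alpha^T +
             (ursubmx J + ursubmx A))))
      & (forall b : 'cV[R]_k,
           hatm b = mc b <->
           (dlsubmx Sigma *m invmx (ulsubmx Sigma) +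
            invmx hatM *m (alpha *m ulsubmx M + dlsubmx M)) *m b = 0) /\
        hatm 0 = mc 0].
Proof.
move=> A J alpha hatM hatC P drift noise hatm mc Sigmac hatMH hatMC.
pose N := alpha *m ulsubmx M + dlsubmx M.
(* Without noise columns the controllability matrix would have rank 0 instead of l > 0. *)
have n_gt0 : (0 < n1 + n2)%N.
  rewrite lt0n; apply/negP => /eqP n0.
  have := rank_leq_col (\mxrow_(j < l) (hatM ^+ j *m hatC)).
  by rewrite hatMC sum_nat_const n0 muln0 leqNgt hl.
have i0 : 'I_(n1 + n2) := Ordinal n_gt0.
have hatMs := hurwitz_decay hatMH.
have [G GE] := sylvester_surj hatMs ((- 2) *: (hatC *m hatC^T)).
have G_pos := lyapunov_posdef hatMs GE hatMC.
have driftE : drift = block_mx 0 0 N hatM.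
  rewrite /drift -mulmxA (drift_matrix hSigma) /P -{1}(submxK M) mulmx_block.
  by rewrite !mul0mx !addr0 !mul1mx.
have noiseE : noise = Num.sqrt 2 *: col_mx 0 hatC.
  rewrite /noise /P -{1}(submxK C) mulmx_block !mul0mx !addr0 !mul1mx.
  by rewrite /block_mx row_mx0.
have hatCE : hatC = row_mx alpha 1%:M *m C.
  by rewrite -[in RHS](submxK C) mul_row_block !mul1mx.
exists G; split.
- by split=> [//|G' [_ G'E]]; exact: lyapunov_uniq GE G'E.
- by rewrite driftE noiseE => y Y; exact: sde_frozen.
- by rewrite driftE noiseE => y; exact: frozen_invariant_measure.
(* Since Sylvester solutions are unique, hatSigma = Sigma_c just says that Sigma_c solves the
   equation. *)
- have schurP := schur_lyapunovP alpha hSigma; rewrite -hatCE in schurP.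
  split=> [GS|/schurP SE]; last exact: lyapunov_uniq GE SE.
  by apply/schurP; rewrite -[schur Sigma]/Sigmac -GS.
split=> [b|]; last by rewrite /hatm /mc !mulmx0.
rewrite /hatm /mc !mulNmx mulmxDl; split=> [<-|/eqP]; first by rewrite addNr.
by rewrite addr_eq0 => /eqP ->.
Qed.
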